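(* Consider the linear dynamical system with sensor attacks $$\mathbf{x}(t+1)=\mathbf{A}\mathbf{x}(t)+\mathbf{w}(t),\qquad \mathbf{y}(t)=\mathbf{C}\mathbf{x}(t)+\mathbf{v}(t)+\boldsymbol{\phi}(t),$$ with state $\mathbf{x}(t)\in\mathbb{R}^n$ and output $\mathbf{y}(t)\in\mathbb{R}^p$, where $\mathbf{w}(t)\sim\mathcal N(\mathbf 0,\sigma_w^2\mathbf I_n)$ and $\mathbf{v}(t)\sim\mathcal N(\mathbf 0,\sigma_v^2\mathbf I_p)$ are each i.i.d. over time and independent of each other, and $\boldsymbol{\phi}(t)$ is the attack vector of a $k$-adversary with attacked sensor set $\boldsymbol\kappa$. Consider an oracle MMSE estimator (in steady state) that has knowledge of $\boldsymbol\kappa$, and let $\mathbf{s}=\{1,2,\ldots,p\}\setminus\boldsymbol\kappa$. Then there exists an attack sequence $\boldsymbol\phi(t)$ such that the trace of the prediction error covariance of the oracle estimator is bounded from below as $$\mathrm{tr}\left(\mathbb{E}\left(\mathbf{e}(t)\mathbf{e}^T(t)\right)\right)\ge P_{opt,\mathbf{s}},$$ where $\mathbf{e}(t)$ is the oracle estimator's prediction error. Similarly, for the filtering problem, with $\mathbf{e}(t)$ the oracle estimator's filtering error, $$\mathrm{tr}\left(\mathbb{E}\left(\mathbf{e}(t)\mathbf{e}^T(t)\right)\right)\ge F_{opt,\mathbf{s}}.$$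
   Context: **$k$-adversary.** There is a set $\boldsymbol\kappa\subseteq\{1,\ldots,p\}$ of attacked sensors, $|\boldsymbol\kappa|=k$, constant over time. For $j\notin\boldsymbol\kappa$, $\phi_j(t)=0$ for all $t$. For $j\in\boldsymbol\kappa$, $y_j(t)=\mathbf{c}_j^T\mathbf{x}(t)+v_j(t)+\phi_j(t)$ ($\mathbf{c}_j^T$ the $j$th row of $\mathbf{C}$); the adversary observes the actual output $\mathbf{c}_j^T\mathbf{x}(t)+v_j(t)$ of each attacked sensor and may change it arbitrarily through $\phi_j(t)$. It knows $\mathbf A,\mathbf C,\sigma_w^2,\sigma_v^2$ and is limited to causal knowledge of the process noise and of the noise in the good sensors (those not in $\boldsymbol\kappa$). **Prediction and filtering; error; $P_{opt,\mathbf s}$ and $F_{opt,\mathbf s}$.** In prediction the state $\mathbf x(t)$ is estimated by $\hat{\mathbf x}(t)$ from outputs up to time $t-1$; in filtering, from outputs up to time $t$. The error is $\mathbf e(t)=\mathbf x(t)-\hat{\mathbf x}(t)$. MMSE means minimum mean squared error. The setting is the standard Kalman filtering one, and estimators are considered in steady state. For $\mathbf s\subseteq\{1,\ldots,p\}$, $\mathbf C_{\mathbf s}$ is formed by the rows of $\mathbf C$ indexed by $\mathbf s$, and $P_{opt,\mathbf s}$ (resp. $F_{opt,\mathbf s}$) is the trace of the steady-state prediction (resp. filtering) error covariance matrix of the Kalman filter that uses only the sensors in $\mathbf s$, in the absence of attacks. Explicitly, $P_{opt,\mathbf s}=\mathrm{tr}(\mathbf P)$ where $\mathbf P$ is the steady-state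 (stabilizing) solution of $\mathbf P=\mathbf A\mathbf P\mathbf A^T+\sigma_w^2\mathbf I_n-\mathbf A\mathbf P\mathbf C_{\mathbf s}^T(\mathbf C_{\mathbf s}\mathbf P\mathbf C_{\mathbf s}^T+\sigma_v^2\mathbf I)^{-1}\mathbf C_{\mathbf s}\mathbf P\mathbf A^T$, and $F_{opt,\mathbf s}=\mathrm{tr}\big(\mathbf P-\mathbf P\mathbf C_{\mathbf s}^T(\mathbf C_{\mathbf s}\mathbf P\mathbf C_{\mathbf s}^T+\sigma_v^2\mathbf I)^{-1}\mathbf C_{\mathbf s}\mathbf P\big)$; these quantities are assumed to be well defined. *)

(* Defs.v *)
(* MathComp-Analysis, over an arbitrary [R : realType]. *)
From HB Require Import structures.
From mathcomp Require Import all_boot all_order all_algebra.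
From mathcomp Require Import all_classical all_reals all_analysis.
From mathcomp Require Import complex.

Set Implicit Arguments.
Unset Strict Implicit.
Unset Printing Implicit Defensive.

Import Order.TTheory GRing.Theory Num.Theory.
Import numFieldNormedType.Exports.

Local Open Scope classical_set_scope.
Local Open Scope ring_scope.

Definition sigma_of (d : measure_display) (T : measurableType d) (R : realType)
    (F : set (T -> R)) : set (set T) :=
  <<s \bigcup_(f in F) preimage_set_system setT f measurable >>.

(* [g] is a measurable function of the (possibly infinitely many) random
   variables in [F]. *)
Definition determined_by (d : measure_display) (T : measurableType d)
    (R : realType) (F : set (T -> R)) (g : T -> R) : Prop :=
  forall B : set R, measurable B -> sigma_of F (g @^-1` B).

Definition mutually_independent (d : measure_display) (T : measurableType d)
    (R : realType) (P : probability T R) (I : eqType)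
    (X : I -> set (T -> R)) : Prop :=
  forall (s : seq I) (E : I -> set T), uniq s ->
    (forall i, i \in s -> sigma_of (X i) (E i)) ->
    P (\big[setI/setT]_(i <- s) E i) = (\prod_(i <- s) P (E i))%E.

(* Index [None]: the initial state, as one block whose components may be
   dependent; the other blocks are single scalar noise components. *)
Definition noise_blocks (d : measure_display) (T : measurableType d)
    (R : realType) (P : probability T R) (n p : nat)
    (x0 : 'I_n -> {RV P >-> R}) (w : nat -> 'I_n -> {RV P >-> R})
    (v : nat -> 'I_p -> {RV P >-> R})
    (i : option ((nat * 'I_n) + (nat * 'I_p))) : set (T -> R) :=
  match i with
  | None => [set f | exists a, f = (x0 a : T -> R)]
  | Some (inl (t, a)) => [set (w t a : T -> R)]
  | Some (inr (t, j)) => [set (v t j : T -> R)]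
  end.

(* [N(0, sigma^2 I)] is the law of a vector with independent [N(0, sigma^2)]
   components; [normal_prob] takes the standard deviation.  The law of the
   initial state is only assumed to have finite second moments, which includes
   the Gaussian (and the deterministic) case. *)
Definition gaussian_noise_model (d : measure_display) (T : measurableType d)
    (R : realType) (P : probability T R) (n p : nat) (sigma_w sigma_v : R)
    (x0 : 'I_n -> {RV P >-> R}) (w : nat -> 'I_n -> {RV P >-> R})
    (v : nat -> 'I_p -> {RV P >-> R}) : Prop :=
  [/\ forall t a B, measurable B ->
        distribution P (w t a) B = normal_prob 0 sigma_w B,
      forall t j B, measurable B ->
        distribution P (v t j) B = normal_prob 0 sigma_v B,
      forall a, (x0 a : T -> R) \in Lfun P 2%:E
    & mutually_independent P (noise_blocks x0 w v)].

Definition vec (d : measure_display) (T : measurableType d)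
    (R : realType) (P : probability T R) (m : nat) (X : 'I_m -> {RV P >-> R})
    (omega : T) : 'cV[R]_m := \col_i X i omega.

Fixpoint state (d : measure_display) (T : measurableType d)
    (R : realType) (P : probability T R) (n : nat) (A : 'M[R]_n)
    (x0 : 'I_n -> {RV P >-> R}) (w : nat -> 'I_n -> {RV P >-> R}) (t : nat)
    (omega : T) : 'cV[R]_n :=
  if t is t'.+1 then A *m state A x0 w t' omega + vec (w t') omega
  else vec x0 omega.

Definition output (d : measure_display) (T : measurableType d)
    (R : realType) (P : probability T R) (n p : nat) (A : 'M[R]_n)
    (C : 'M[R]_(p, n)) (x0 : 'I_n -> {RV P >-> R})
    (w : nat -> 'I_n -> {RV P >-> R})
    (v phi : nat -> 'I_p -> {RV P >-> R}) (t : nat) (omega : T) : 'cV[R]_p :=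
  C *m state A x0 w t omega + vec (v t) omega + vec (phi t) omega.

(* What the adversary knows at time [t]: the actual (unattacked) outputs of the
   attacked sensors, the process noise and the noise of the good sensors, all
   up to time [t]. *)
Definition adversary_info (d : measure_display) (T : measurableType d)
    (R : realType) (P : probability T R) (n p : nat) (A : 'M[R]_n)
    (C : 'M[R]_(p, n)) (x0 : 'I_n -> {RV P >-> R})
    (w : nat -> 'I_n -> {RV P >-> R})
    (v : nat -> 'I_p -> {RV P >-> R}) (kappa : {set 'I_p}) (t : nat) :
    set (T -> R) :=
  [set f | exists tau, (tau <= t)%N /\
    [\/ exists2 j, j \in kappa &
          f = (fun omega => (C *m state A x0 w tau omega) j 0 + v tau j omega),
        exists a, f = (w tau a : T -> R)
      | exists2 j, j \notin kappa & f = (v tau j : T -> R)]].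

Definition k_adversary (d : measure_display) (T : measurableType d)
    (R : realType) (P : probability T R) (n p k : nat) (A : 'M[R]_n)
    (C : 'M[R]_(p, n)) (x0 : 'I_n -> {RV P >-> R})
    (w : nat -> 'I_n -> {RV P >-> R})
    (v : nat -> 'I_p -> {RV P >-> R}) (kappa : {set 'I_p})
    (phi : nat -> 'I_p -> {RV P >-> R}) : Prop :=
  [/\ #|kappa| = k,
      forall t j omega, j \notin kappa -> phi t j omega = 0
    & forall t j, j \in kappa ->
        determined_by (adversary_info A C x0 w v kappa t) (phi t j)].

(* Time [t] gives the data for predicting [x(t)], time [t.+1] for filtering. *)
Definition outputs_before (T : Type) (R : realType) (p : nat)
    (y : nat -> T -> 'cV[R]_p) (t : nat) : set (T -> R) :=
  [set f | exists tau j, (tau < t)%N /\ f = (fun omega => y tau omega j 0)].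

Definition mse (d : measure_display) (T : measurableType d) (R : realType)
    (P : probability T R) (n : nat) (x xhat : T -> 'cV[R]_n) : \bar R :=
  ('E_P[(fun omega => \sum_i ((x omega - xhat omega) i 0) ^+ 2)%R])%E.

Definition error_cov (d : measure_display) (T : measurableType d)
    (R : realType) (P : probability T R) (n : nat) (e : T -> 'cV[R]_n) :
    'M[\bar R]_n :=
  \matrix_(i, j) ('E_P[(fun omega => e omega i 0 * e omega j 0)%R])%E.

(* [xhat] has minimum mean squared error among all measurable functions of the
   observations in [F], linear or not.  The attacked set is fixed before the
   minimization, so [xhat] and its competitors may depend on it: this is the
   oracle estimator. *)
Definition mmse_estimator (d : measure_display) (T : measurableType d)
    (R : realType) (P : probability T R) (n : nat) (F : set (T -> R))
    (x xhat : T -> 'cV[R]_n) : Prop :=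
  (forall i, determined_by F (fun omega => xhat omega i 0)) /\
  forall g : T -> 'cV[R]_n,
    (forall i, determined_by F (fun omega => g omega i 0)) ->
    (mse P x xhat <= mse P x g)%E.

(* The steady-state value of [tr E(e(t) e(t)^T)] is [l]. *)
Definition steady_error (d : measure_display) (T : measurableType d)
    (R : realType) (P : probability T R) (n : nat)
    (e : nat -> T -> 'cV[R]_n) (l : R) : Prop :=
  \tr (error_cov P (e t)) @[t --> \oo] --> l%:E.

Definition sensor_rows (R : realType) (n p : nat) (C : 'M[R]_(p, n))
    (s : {set 'I_p}) : 'M[R]_(#|s|, n) :=
  rowsub (fun i : 'I_#|s| => enum_val i) C.

Definition schur_stable (R : realType) (n : nat) (M : 'M[R]_n) : Prop :=
  forall z : R[i], eigenvalue (map_mx (real_complex R) M) z -> `|z| < 1.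

(* [S C^T (C S C^T + sigma_v^2 I)^-1]; the prediction gain is [A] times it. *)
Definition kalman_gain (R : realType) (n m : nat) (C : 'M[R]_(m, n))
    (sigma_v : R) (S : 'M[R]_n) : 'M[R]_(n, m) :=
  S *m C^T *m invmx (C *m S *m C^T + (sigma_v ^+ 2)%:M).

Definition filter_cov (R : realType) (n m : nat) (C : 'M[R]_(m, n))
    (sigma_v : R) (S : 'M[R]_n) : 'M[R]_n :=
  S - kalman_gain C sigma_v S *m C *m S.

Definition steady_prediction_cov (R : realType) (n m : nat) (A : 'M[R]_n)
    (C : 'M[R]_(m, n)) (sigma_w sigma_v : R) (S : 'M[R]_n) : Prop :=
  [/\ S^T = S,
      forall u : 'rV[R]_n, 0 <= (u *m S *m u^T) 0 0,
      S = A *m S *m A^T + (sigma_w ^+ 2)%:M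
          - A *m kalman_gain C sigma_v S *m C *m S *m A^T
    & schur_stable (A - A *m kalman_gain C sigma_v S *m C)].

(* Main.v *)
Require Import Defs.
From HB Require Import structures.
From mathcomp Require Import all_boot all_order all_algebra.
From mathcomp Require Import all_classical all_reals all_analysis.
From mathcomp Require Import measurable_realfun ring lra.

(** The attack replaces every attacked output by the constant 0: the adversary
    sees the true output of each attacked sensor, hence can subtract it.  From
    then on the outputs carry exactly the information of the good sensors, and
    it remains to see that the mean squared error of the best estimator built
    on those converges to the trace of the stabilizing solution [Ps] of the
    Riccati equation (respectively, of its filtered version).  This is done by
    squeezing.

    Upper bound.  The minimum error is at most that of the observer run with
    the constant gain computed from [Ps] and started at 0.  Its error is a
    linear function of the initial state plus a linear function of the noise,
    so that its energy is bounded by a matrix [Sigma_t] obeying the linear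
    recursion that [Ps] is a fixed point of ([error_energy_le],
    [steady_gain_gram]).

    Lower bound.  Revealing the initial state can only help.  Once it is known
    the problem is Gaussian, whatever the law of the initial state, and the
    Kalman filter started with covariance 0 is optimal among all measurable
    estimators: the coefficients of its error with respect to the noise are
    orthogonal to those of every past output ([kerr_orth], [kferr_orth]), and
    its covariance is the Riccati iterate [S_t] from 0.  Orthogonality turns
    into optimality through [orthogonal_noise_second_moment]: if [Z] is a
    standard Gaussian vector given a sigma-algebra and [h] depends only on that
    sigma-algebra and on the [b.Z] with [b] orthogonal to [a], then
    [E (a.Z + h)^2 = |a|^2 + E h^2].  Rotations in coordinate planes preserve
    standard Gaussian vectors ([standard_given_givens]), so [a] can be taken
    to have one nonzero coordinate; then [a.Z] is symmetric and independent of
    [h], and the parallelogram law finishes.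

    Convergence.  Each time step adds the noise [sigma_w^2 I], which dominates
    a fixed fraction [1 - rho] of [Ps].  An inequality [theta Ps <= S_t]
    between quadratic forms therefore improves, one step later, to one with
    [1 - theta] multiplied by [rho]; in the same way the excess over 1 of a
    factor [tau] with [Sigma_t <= tau Ps] shrinks by [rho].  Hence
    [(1 - rho^t) Ps <= S_t] and [Sigma_t <= (1 + c rho^t) Ps]
    ([riccati_lower], [steady_gain_upper]), and both bounds are inherited by
    the filtered covariances. *)

Set Implicit Arguments.
Unset Strict Implicit.
Unset Printing Implicit Defensive.

Import Order.TTheory GRing.Theory Num.Theory.
Import numFieldNormedType.Exports.

Local Open Scope classical_set_scope.
Local Open Scope ring_scope.

(** * Integration: image measures, affine changes of variables, densities *)

Section image_measure.
Local Open Scope ereal_scope.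
Context d d' (T1 : measurableType d) (T2 : measurableType d') {R : realType}.

(** Packages [pushforward m f] as a measure from a proof that [f] is measurable,
    without requiring [f] to be a bundled measurable function. *)
Definition image_measure (m : {measure set T1 -> \bar R}) (f : T1 -> T2)
    (mf : measurable_fun setT f) : {measure set T2 -> \bar R} :=
  measure_function_pushforward__canonical__measure_function_Measure m mf.

Lemma ge0_integral_image_measure m f (mf : measurable_fun setT f)
    (g : T2 -> \bar R) :
  measurable_fun setT g -> (forall y, 0 <= g y) ->
  \int[image_measure m mf]_y g y = \int[m]_x g (f x).
Proof. by move=> mg g0; rewrite ge0_integral_pushforward// preimage_setT. Qed.

End image_measure.

Section change_of_variables.
Local Open Scope ereal_scope.
Context {R : realType}.
Notation mu := (@lebesgue_measure R).

(** The two sides compare Lebesgue measure with [|a|] times its image under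
    [x |-> a x + b]; these agree on half-open intervals, hence everywhere. *)
Lemma ge0_integral_affine (a b : R) (f : R -> \bar R) : a != 0%R ->
  measurable_fun setT f -> (forall x, 0 <= f x) ->
  \int[mu]_x f (a * x + b)%R = `|a|^-1%:E * \int[mu]_x f x.
Proof.
move=> a0 mf f0.
have mh : measurable_fun setT (fun x : R => (a * x + b)%R).
  by apply: measurable_funD => //; exact: measurable_funM.
pose h := fun x : R => (a * x + b)%R.
pose m := mscale (NngNum (normr_ge0 a))
  (image_measure (T2 := measurableTypeR R) mu mh).
have muE A : measurable A -> mu A = m A.
  apply: lebesgue_measure_unique => X [[u v]] _ <-.
  transitivity (`|a|%:E * mu (h @^-1` `]u, v]%classic)); last by [].
  have -> : h @^-1` `]u, v]%classic = if (0 < a)%R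
      then `]((u - b) / a)%R, ((v - b) / a)%R]%classic
      else `[((v - b) / a)%R, ((u - b) / a)%R[%classic.
    apply/seteqP; case: ltP => [ap|]; last first.
      rewrite le_eqVlt (negPf a0) /= => an.
      split=> x /=; rewrite !in_itv/= ler_ndivrMr// ltr_ndivlMr// ltrBlDr lerBrDr
        (mulrC x) andbC //.
    by split=> x /=; rewrite !in_itv/= ltr_pdivrMr// ler_pdivlMr// ltrBlDr lerBrDr
      (mulrC x).
  case: ltP => [ap|]; rewrite !lebesgue_measure_itv/= !lte_fin.
    rewrite ltr_pM2r ?invr_gt0// ltrD2r; case: ifPn => _; last by rewrite mule0.
    rewrite -!EFinB -EFinM gtr0_norm//; congr EFin.
    by field; rewrite gt_eqF.
  rewrite le_eqVlt (negPf a0) /= => an.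
  rewrite ltr_nM2r ?invr_lt0// ltrD2r; case: ifPn => _; last by rewrite mule0.
  rewrite -!EFinB -EFinM ltr0_norm//; congr EFin.
  by field; rewrite lt_eqF.
have -> : \int[mu]_x f x = \int[m]_x f x.
  by apply: eq_measure_integral => A mA _; exact: muE.
rewrite ge0_integral_mscale//= ge0_integral_image_measure//.
by rewrite muleA -EFinM mulVf ?normr_eq0// mul1e.
Qed.

End change_of_variables.

Section density.
Local Open Scope ereal_scope.
Context d (T : measurableType d) (R : realType).
Variables mu nu : {measure set T -> \bar R}.

Import HBNNSimple.

(** By monotone convergence it suffices to treat nonnegative simple functions,
    where the claim is the hypothesis on [nu] applied to each level set. *)
Lemma ge0_integral_density (g : T -> R) (f : T -> \bar R) :
  measurable_fun setT g -> (forall x, 0 <= g x)%R ->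
  (forall A, measurable A -> nu A = \int[mu]_(x in A) (g x)%:E) ->
  measurable_fun setT f -> (forall x, 0 <= f x) ->
  \int[nu]_x f x = \int[mu]_x (f x * (g x)%:E).
Proof.
move=> mg g0 nuE mf f0.
have mgE : measurable_fun setT (EFin \o g) by exact/measurable_EFinP.
pose f_ := nnsfun_approx measurableT mf.
have fnd x n m : (n <= m)%N -> (f_ n x <= f_ m x)%R.
  by move=> nm; exact/lefP/nd_nnsfun_approx.
have fcvg x : (f_ n x)%:E @[n --> \oo] --> f x by exact: cvg_nnsfun_approx.
transitivity (limn (fun n => \int[nu]_x (f_ n x)%:E)).
  rewrite -monotone_convergence//=.
  - by apply: eq_integral => x _; apply/esym/cvg_lim.
  - by move=> n; exact/measurable_EFinP/measurable_funTS.
  - by move=> n x _; rewrite lee_fin.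
  - by move=> x _ ? ? mn; rewrite lee_fin fnd.
transitivity (limn (fun n => \int[mu]_x ((f_ n x)%:E * (g x)%:E))); last first.
  rewrite -monotone_convergence//=.
  - apply: eq_integral => x _; apply/cvg_lim => //.
    by apply: cvgeMr.
  - move=> n; apply: emeasurable_funM => //.
    exact/measurable_EFinP/measurable_funTS.
  - by move=> n x _; rewrite -EFinM lee_fin mulr_ge0.
  - move=> x _ ? ? mn; rewrite -!EFinM lee_fin ler_wpM2r//.
    exact: fnd.
apply: congr_lim; apply/funext => n /=.
under eq_integral do rewrite fimfunE -fsumEFin//.
rewrite ge0_integral_fsum//; last 2 first.
  - by move=> r; exact/measurable_EFinP/measurableT_comp.
  - by move=> r x _; rewrite EFinM nnfun_muleindic_ge0.
under [RHS]eq_integral.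
  move=> x xD; rewrite fimfunE -fsumEFin// ge0_mule_fsuml; last first.
    by move=> r; rewrite EFinM nnfun_muleindic_ge0.
  over.
rewrite [RHS]ge0_integral_fsum//; last 2 first.
  - move=> r; apply: emeasurable_funM => //.
    exact/measurable_EFinP/measurableT_comp.
  - move=> r x _; rewrite mule_ge0 ?lee_fin//.
    by have := nnfun_muleindic_ge0 (f_ n) r x; rewrite -EFinM lee_fin.
apply: eq_fsbigr => r _.
rewrite integralZl_indic_nnsfun// integral_indic// setIT nuE//.
have [r0|r0] := ltP r 0%R.
  rewrite preimage_nnfun0// integral_set0 mule0.
  by rewrite integral0_eq// => x _; rewrite indicE in_set0 mulr0 mul0e.
rewrite -ge0_integralZl ?lee_fin//.
- rewrite integral_mkcond; apply: eq_integral => x _; rewrite patchE indicE.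
  by case: ifPn => _; rewrite ?mulr1 ?mulr0 ?mul0e.
- by apply/measurable_EFinP; exact: measurable_funTS.
- by move=> x _; rewrite lee_fin.
Qed.

End density.

(** * The standard normal law on the line *)

Section product_rectangles.
Local Open Scope ereal_scope.
Context d1 d2 (T1 : measurableType d1) (T2 : measurableType d2) (R : realType).

(** Rectangles form a pi-system generating the product sigma-algebra. *)
Lemma eq_measure_rectangles (m1 m2 : {measure set (T1 * T2) -> \bar R}) :
  m1 setT < +oo ->
  (forall A B, measurable A -> measurable B -> m1 (A `*` B) = m2 (A `*` B)) ->
  forall X, measurable X -> m1 X = m2 X.
Proof.
move=> m1oo m12 X mX.
pose C := [set A `*` B | A in @measurable _ T1 & B in @measurable _ T2].
apply: (measure_unique C (fun=> setT)) => //.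
- by rewrite measurable_prod_measurableType.
- move=> _ _ [A1 mA1 [B1 mB1 <-]] [A2 mA2 [B2 mB2 <-]].
  exists (A1 `&` A2); first exact: measurableI.
  by exists (B1 `&` B2); [exact: measurableI|rewrite setXI].
- by move=> _; exists setT => //; exists setT => //; rewrite setXTT.
- by rewrite bigcup_const//; exists 0%N.
- by move=> _ [A mA [B mB <-]]; exact: m12.
Qed.

End product_rectangles.

Section standard_normal.
Local Open Scope ereal_scope.
Context {R : realType}.
Notation mu := (@lebesgue_measure R).
Notation N := (@normal_prob R 0 1).
Notation phi := (@normal_pdf R 0 1).

Let mphi : measurable_fun setT phi. Proof. exact: measurable_normal_pdf. Qed.
Let phi0 x : (0 <= phi x)%R. Proof. exact: normal_pdf_ge0. Qed.

Lemma normal_pdf01E x : phi x = (normal_peak 1 * expR (- x ^+ 2 / 2))%R.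
Proof.
rewrite normal_pdfE ?oner_eq0// /normal_fun subr0 expr1n.
by congr (_ * expR _)%R.
Qed.

Lemma normal_pdf01_rot c s x y : (c ^+ 2 + s ^+ 2 = 1)%R ->
  (phi (c * x + s * y) * phi (c * y - s * x) = phi x * phi y)%R.
Proof.
move=> cs; rewrite !normal_pdf01E mulrACA -expRD [RHS]mulrACA -expRD.
congr (_ * expR _)%R.
transitivity (- ((c ^+ 2 + s ^+ 2) * (x ^+ 2 + y ^+ 2)) / 2)%R; first by field.
by rewrite cs; field.
Qed.

Lemma ge0_integral_normal (f : R -> \bar R) :
  measurable_fun setT f -> (forall x, 0 <= f x) ->
  \int[N]_x f x = \int[mu]_x (f x * (phi x)%:E).
Proof. by move=> mf f0; exact: (@ge0_integral_density _ (measurableTypeR R) R mu N phi). Qed.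

Lemma normal_indicE (B : set R) : measurable B ->
  N B = \int[mu]_x (\1_B x * phi x)%:E.
Proof.
move=> mB; rewrite /normal_prob integral_mkcond; apply: eq_integral => x _.
by rewrite patchE indicE; case: ifPn; rewrite ?mul1r ?mul0r.
Qed.

Lemma normal_opp (B : set R) : measurable B -> N (-%R @^-1` B) = N B.
Proof.
move=> mB; have mB' : measurable (-%R @^-1` B).
  by rewrite -[X in measurable X]setTI; exact: oppr_measurable.
rewrite !normal_indicE//.
pose f x := (\1_B x * phi x)%:E.
have := @ge0_integral_affine R (-1) 0 f.
rewrite normrN1 invr1 mul1e /f => <-//.
- apply: eq_integral => x _; rewrite addr0 mulN1r.
  by rewrite !normal_pdf01E sqrrN.
- by apply/measurable_EFinP/measurable_funM => //; exact: measurable_indic.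
- by move=> x; rewrite lee_fin mulr_ge0.
Qed.

Lemma normal_scale (s : R) (B : set R) : (0 < s)%R -> measurable B ->
  normal_prob 0 s ((fun x => x / s)%R @^-1` B) = N B.
Proof.
move=> s0 mB.
have mB' : measurable ((fun x => x / s)%R @^-1` B).
  rewrite -[X in measurable X]setTI.
  by apply: measurable_funM => //.
rewrite normal_indicE// /normal_prob integral_mkcond.
pose f x := (\1_B x * normal_pdf 0 s (s * x))%:E.
have mf : measurable_fun setT f.
  apply/measurable_EFinP/measurable_funM; first exact: measurable_indic.
  apply: measurableT_comp; first exact: measurable_normal_pdf.
  exact: measurable_funM.
have f0 x : 0 <= f x by rewrite lee_fin mulr_ge0 ?normal_pdf_ge0.
have -> : \int[mu]_x ((fun x => (normal_pdf 0 s x)%:E) \_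
      ((fun x => x / s)%R @^-1` B)) x = \int[mu]_x f (s^-1 * x + 0)%R.
  apply: eq_integral => x _; rewrite patchE /f indicE addr0 mulrA divff ?gt_eqF//.
  rewrite mul1r -(mulrC x) (_ : (x \in _) = (x / s \in B)%R); last first.
    by apply/idP/idP; rewrite !inE.
  by case: ifPn; rewrite ?mul1r ?mul0r.
rewrite ge0_integral_affine ?invr_eq0 ?gt_eqF// gtr0_norm ?invr_gt0// invrK.
rewrite -ge0_integralZl ?lee_fin ?ltW//.
apply: eq_integral => x _; rewrite /f -EFinM; congr EFin.
rewrite mulrCA; congr (_ * _)%R.
rewrite !normal_pdfE ?oner_eq0 ?gt_eqF// mulrA; congr (_ * _)%R; last first.
  by rewrite /normal_fun !subr0; congr expR; field; rewrite gt_eqF.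
rewrite /normal_peak -!mulrnAr expr1n mul1r sqrtrM ?sqr_ge0// sqrtr_sqr gtr0_norm//.
by rewrite invfM mulrA divff ?mul1r// gt_eqF.
Qed.

End standard_normal.

(** * Rotation invariance of the planar Gaussian *)

Section planar_rotation.
Local Open Scope ereal_scope.
Context {R : realType}.
Notation mu := (@lebesgue_measure R).
Notation N := (@normal_prob R 0 1).
Notation phi := (@normal_pdf R 0 1).
(* The copy of R that carries the sigma-algebra of [lebesgue_measure]. *)
Let RR := measurableTypeR R.

(** Two one-dimensional affine substitutions, [u = c x + s y] at fixed [y] and
    then [v = (y - s u) / c] at fixed [u], with Tonelli in between; the
    Jacobians [1 / |c|] and [|c|] cancel. *)
Lemma ge0_integral_rot (c s : R) (G : RR * RR -> \bar R) :
  c != 0%R -> (c ^+ 2 + s ^+ 2 = 1)%R ->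
  measurable_fun setT G -> (forall z, 0 <= G z) ->
  \int[mu]_x \int[mu]_y G (c * x + s * y, c * y - s * x)%R =
  \int[mu]_x \int[mu]_y G (x, y).
Proof.
move=> c0 cs mG G0.
have mfst : measurable_fun [set: RR * RR] fst by exact: measurable_fst.
have msnd : measurable_fun [set: RR * RR] snd by exact: measurable_snd.
have mlin (f g : RR * RR -> RR) (a b : R) :
    measurable_fun setT f -> measurable_fun setT g ->
    measurable_fun setT (fun z => (a * f z + b * g z)%R : RR).
  by move=> mf mg; apply: measurable_funD; apply: measurable_funM.
have mpair (f g : RR * RR -> RR) : measurable_fun setT f ->
    measurable_fun setT g -> measurable_fun setT (fun z => G (f z, g z)).
  move=> mf mg; apply: (measurableT_comp mG); exact: measurable_fun_pair.
have mrow (f : RR -> RR) : measurable_fun setT f ->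
    measurable_fun setT (fun u => G (u, f u)).
  move=> mf; apply: (measurableT_comp mG).
  by apply: measurable_fun_pair => //; exact: measurable_id.
transitivity (\int[mu]_y \int[mu]_x G (c * x + s * y, c * y - s * x)%R).
  apply: (@fubini_tonelli _ _ RR RR R mu mu
    (fun z => G (c * z.1 + s * z.2, c * z.2 - s * z.1)%R)) => //.
  apply: mpair; first exact: mlin.
  under eq_fun do rewrite -mulNr.
  exact: mlin.
pose H (u y : R) := G (u, c^-1 * y + - (s / c) * u)%R.
transitivity (\int[mu]_y (`|c|^-1%:E * \int[mu]_u H u y)).
  apply: eq_integral => y _.
  rewrite -(ge0_integral_affine (s * y) (f := H ^~ y) c0); last 2 first.
  - apply: (mrow (fun u => c^-1 * y + - (s / c) * u)%R); apply: measurable_funD => //.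
  - by move=> x; exact: G0.
  apply: eq_integral => x _; rewrite /H; congr (G (_, _)).
  transitivity (c^-1 * ((c ^+ 2 + s ^+ 2) * y - s * (c * x + s * y)))%R.
    by field.
  by rewrite cs; field.
rewrite ge0_integralZl//; last 2 first.
- apply: (@measurable_fun_fubini_tonelli_G _ _ RR RR R mu
    (fun z => H z.1 z.2)); last by move=> z; exact: G0.
  apply: mpair => //.
  under eq_fun do rewrite addrC; exact: mlin.
- by move=> y _; apply: integral_ge0 => u _; exact: G0.
have -> : \int[mu]_y \int[mu]_u H u y = \int[mu]_u \int[mu]_y H u y.
  apply/esym; apply: (@fubini_tonelli _ _ RR RR R mu mu
    (fun z => H z.1 z.2)); last by move=> z; exact: G0.
  apply: mpair => //.
  under eq_fun do rewrite addrC; exact: mlin.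
have ci0 : (c^-1 != 0)%R by rewrite invr_eq0.
transitivity (`|c|^-1%:E * \int[mu]_u (`|c|%:E * \int[mu]_v G (u, v))).
  congr (_ * _); apply: eq_integral => u _; rewrite /H.
  rewrite (ge0_integral_affine _ (f := fun v => G (u, v)) ci0)//.
    by rewrite normfV invrK.
  by apply: (measurableT_comp mG); exact: measurable_fun_pair.
rewrite ge0_integralZl//; last 2 first.
- exact: (@measurable_fun_fubini_tonelli_F _ _ RR RR R mu G).
- by move=> y _; exact: integral_ge0.
by rewrite muleA -EFinM mulVf ?normr_eq0// mul1e.
Qed.

(** The joint density depends on [x^2 + y^2] only, which the rotation
    preserves. *)
Lemma product_normal_rot (c s : R) (A B : set RR) :
  c != 0%R -> (c ^+ 2 + s ^+ 2 = 1)%R -> measurable A -> measurable B ->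
  (N \x N) [set z | A (c * z.1 + s * z.2)%R /\ B (c * z.2 - s * z.1)%R]
  = N A * N B.
Proof.
move=> c0 cs mA mB; set S := [set z | _].
have mS : measurable S.
  rewrite (_ : S = (fun z : RR * RR => (c * z.1 + s * z.2)%R : RR) @^-1` A `&`
    (fun z : RR * RR => (c * z.2 - s * z.1)%R : RR) @^-1` B)//.
  apply: measurableI; rewrite -[X in measurable X]setTI.
    apply: (measurable_funD (D := setT)) => //; apply: measurable_funM => //.
  apply: (measurable_funB (D := setT)) => //; apply: measurable_funM => //.
have mphi : measurable_fun [set: RR] phi by exact: measurable_normal_pdf.
pose G (z : RR * RR) := (\1_A z.1 * \1_B z.2 * (phi z.1 * phi z.2))%:E.
have mG : measurable_fun setT G.
  apply/measurable_EFinP; apply: measurable_funM; apply: measurable_funM.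
  - by apply: measurableT_comp => //; exact: measurable_indic.
  - by apply: measurableT_comp => //; exact: measurable_indic.
  - exact: measurableT_comp.
  - exact: measurableT_comp.
have G0 z : 0 <= G z.
  by rewrite lee_fin !mulr_ge0 ?normal_pdf_ge0.
have mS1 : measurable_fun setT (fun z => (\1_S z)%:E : \bar R).
  by apply/measurable_EFinP; exact: measurable_indic.
transitivity (\int[N \x N]_z (\1_S z)%:E); first by rewrite integral_indic// setIT.
rewrite fubini_tonelli1//.
transitivity (\int[mu]_x \int[mu]_y G (c * x + s * y, c * y - s * x)%R).
  rewrite /fubini_F ge0_integral_normal; last 2 first.
  - exact: (@measurable_fun_fubini_tonelli_F _ _ RR RR R N
      (fun z => (\1_S z)%:E)).
  - by move=> x; apply: integral_ge0 => y _; rewrite lee_fin.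
  apply: eq_integral => x _.
  rewrite ge0_integral_normal; last 2 first.
  - by apply: (measurableT_comp mS1); exact: measurable_fun_pair.
  - by move=> y; rewrite lee_fin.
  rewrite muleC -ge0_integralZl ?lee_fin ?normal_pdf_ge0//; last 2 first.
  - apply: emeasurable_funM; last exact/measurable_EFinP.
    by apply: (measurableT_comp mS1); exact: measurable_fun_pair.
  - by move=> y _; rewrite -EFinM lee_fin mulr_ge0 ?normal_pdf_ge0.
  apply: eq_integral => y _; rewrite /G /= -!EFinM normal_pdf01_rot//; congr EFin.
  rewrite mulrCA; congr (_ * _)%R; rewrite !indicE -natrM mulnb; congr (_%:R).
  by congr nat_of_bool; apply/idP/andP => [|[]]; rewrite !inE.
rewrite ge0_integral_rot//.
rewrite (normal_indicE mA) (normal_indicE mB).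
have i0 C x : 0 <= (\1_C x * phi x)%:E.
  by rewrite lee_fin mulr_ge0 ?normal_pdf_ge0.
have mi C : measurable C -> measurable_fun [set: RR] (fun x => (\1_C x * phi x)%:E).
  by move=> mC; apply/measurable_EFinP/measurable_funM.
rewrite -ge0_integralZr//; [|exact: mi|exact: integral_ge0].
apply: eq_integral => x _; rewrite -ge0_integralZl//; last exact: mi.
by apply: eq_integral => y _; rewrite /G /= -EFinM mulrACA.
Qed.

End planar_rotation.

(** * The second moment of the standard normal law *)

Section normal_second_moment.
Local Open Scope ereal_scope.
Context {R : realType}.
Notation mu := (@lebesgue_measure R).
Notation N := (@normal_prob R 0 1).
Notation phi := (@normal_pdf R 0 1).
Let RR := measurableTypeR R.

Lemma is_derive_normal_pdf01 (x : R) : is_derive x 1%R phi (- (x * phi x))%R.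
Proof.
have -> : phi = fun x : R => (normal_peak 1 * expR (- x ^+ 2 / 2))%R.
  by apply/funext => y; rewrite normal_pdf01E.
have d1 : is_derive x 1%R (fun x : R => - x ^+ 2 / 2 : R)%R (- x)%R.
  by apply: is_derive_eq; rewrite /GRing.scale /=; field.
have d2 := @is_derive1_comp R expR (fun x : R => - x ^+ 2 / 2)%R x _ _
  (is_derive_expR (- x ^+ 2 / 2)%R) d1.
apply: is_derive_eq.
by rewrite /GRing.scale /=; ring.
Qed.

Lemma cvg_normal_pdf01 : phi x @[x --> +oo%R] --> (0 : R)%R.
Proof.
have -> : phi = fun x : R => (normal_peak 1 * gauss_fun (x * (Num.sqrt 2)^-1))%R.
  apply/funext => y; rewrite normal_pdf01E /gauss_fun exprMn exprVn sqr_sqrtr//.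
  by rewrite mulNr.
rewrite -[X in _ --> X](mulr0 (normal_peak 1)).
apply: cvgM; first exact: cvg_cst.
apply: (cvg_comp (fun x : R => x * (Num.sqrt 2)^-1)%R gauss_fun).
  by apply: gt0_cvgMly; [rewrite invr_gt0 sqrtr_gt0|exact: cvg_id].
exact: cvg_gauss_fun.
Qed.

Lemma integral_tail_normal (u : R) : (0 <= u)%R ->
  \int[mu]_(x in `[u, +oo[) (x * phi x)%:E = (phi u)%:E.
Proof.
move=> u0.
have dF (x : R) : is_derive x 1%R (fun x => - phi x)%R (x * phi x)%R.
  have := is_derive_normal_pdf01 x => d.
  by apply: is_derive_eq; rewrite opprK.
have cphi : continuous phi by apply: continuous_normal_pdf; rewrite oner_eq0.
rewrite (@ge0_continuous_FTC2y R _ (fun x => - phi x)%R u 0%R).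
- by rewrite sub0e EFinN oppeK.
- by move=> x ux; rewrite mulr_ge0 ?normal_pdf_ge0// (le_trans u0).
- apply: continuous_subspaceT => x.
  by apply: cvgM; [exact: cvg_id|exact: cphi].
- by have := cvgN cvg_normal_pdf01; rewrite oppr0; apply.
- by move=> x _; exact: ex_derive.
- by apply: cvgN; apply: cvg_at_right_filter; exact: cphi.
- by move=> x _; rewrite derive1E derive_val.
Qed.

(** Writing [x] as the length of [[0, x]], Tonelli turns the integral of
    [x * (x phi x)] over [x >= 0] into the integral over [u >= 0] of the tail
    integral of [x phi x] from [u], which is [phi u] since [phi' x = - x phi x]. *)
Lemma normal_second_moment : \int[N]_x (x ^+ 2)%:E = 1.
Proof.
have cphi : continuous phi by apply: continuous_normal_pdf; rewrite oner_eq0.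
have mphi : measurable_fun [set: RR] phi by exact: measurable_normal_pdf.
rewrite ge0_integral_normal; last 2 first.
- by apply/measurable_EFinP; exact: measurable_funX.
- by move=> x; rewrite lee_fin sqr_ge0.
have even2 : (fun x : R => x ^+ 2 * phi x)%R =1 (fun x : R => x ^+ 2 * phi x)%R \o -%R.
  by move=> x /=; rewrite !normal_pdf01E sqrrN.
have even0 : phi =1 phi \o -%R by move=> x /=; rewrite !normal_pdf01E sqrrN.
under eq_integral do rewrite -EFinM.
rewrite (ge0_symfun_integralT _ _ even2); last 2 first.
- by move=> x; rewrite mulr_ge0 ?sqr_ge0 ?normal_pdf_ge0.
- by move=> x; apply: cvgM; [exact: exprn_continuous|exact: cphi].
rewrite -[RHS](@integral_normal_pdf R 0 1) (ge0_symfun_integralT _ cphi even0); last first.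
  by move=> x; exact: normal_pdf_ge0.
congr (_ * _).
pose S : set (RR * RR) := [set z | (0 <= z.2)%R /\ (z.2 <= z.1)%R].
have mS : measurable S.
  have -> : S = (snd : RR * RR -> RR) @^-1` `[0%R, +oo[%classic `&`
      (fun z : RR * RR => (z.1 - z.2)%R : RR) @^-1` `[0%R, +oo[%classic.
    by apply/seteqP; split=> -[x y] /=; rewrite /S /= !in_itv/= !andbT subr_ge0.
  apply: measurableI; rewrite -[X in measurable X]setTI.
    exact: (@measurable_snd _ _ RR RR).
  by apply: (measurable_funB (D := setT)).
(* S is the region 0 <= u <= x of the plane of (x, u). *)
pose g (z : RR * RR) := (\1_S z * (z.1 * phi z.1))%:E.
have mg : measurable_fun setT g.
  apply/measurable_EFinP; apply: measurable_funM; first exact: measurable_indic.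
  by apply: measurable_funM => //; exact: measurableT_comp.
have g0 z : 0 <= g z.
  rewrite lee_fin indicE; have [|_] := boolP (z \in S); last by rewrite mul0r.
  rewrite inE => -[z0 z1]; rewrite mul1r mulr_ge0 ?normal_pdf_ge0//.
  exact: le_trans z1.
have gE x u : g (x, u) = if ((0 <= u) && (u <= x))%R then (x * phi x)%:E else 0.
  rewrite /g indicE; case: ifPn => [/andP[u0 ux]|].
    by rewrite mem_set ?mul1r.
  by move=> h; rewrite memNset ?mul0r//= => -[u0 ux]; rewrite u0 ux in h.
transitivity (\int[mu]_x \int[mu]_u g (x, u)).
  rewrite integral_mkcond; apply: eq_integral => x _; rewrite patchE.
  case: ifPn => [|]; rewrite ?inE ?notin_setE /= => x0.
    transitivity (\int[mu]_(u in `[0%R, x]) (x * phi x)%:E).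
      rewrite integral_cst//= lebesgue_measure_itv/= lte_fin.
      move: x0; rewrite le_eqVlt => /predU1P[<-|x0].
        by rewrite ltxx mule0 expr0n mul0r.
      by rewrite x0 -EFinB -EFinM subr0; congr EFin; ring.
    rewrite integral_mkcond; apply: eq_integral => u _; rewrite patchE gE.
    by rewrite (_ : (u \in _) = (0 <= u <= x)%R)//; apply/idP/idP;
      rewrite inE/= in_itv.
  rewrite integral0_eq// => u _; rewrite gE; case: ifPn => // /andP[u0 ux].
  by case: x0; exact: le_trans ux.
rewrite (@fubini_tonelli _ _ RR RR R mu mu g)//.
rewrite [RHS]integral_mkcond; apply: eq_integral => u _; rewrite patchE.
case: ifPn => [|]; rewrite ?inE ?notin_setE /= => u0; last first.
  rewrite integral0_eq// => x _; rewrite gE; case: ifPn => // /andP[u0'].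
  by case: u0.
rewrite -integral_tail_normal// [RHS]integral_mkcond.
apply: eq_integral => x _; rewrite patchE gE u0/=.
by rewrite (_ : (x \in _) = (u <= x)%R)//; apply/idP/idP;
  rewrite inE/= in_itv/= andbT.
Qed.

End normal_second_moment.

(** * Standard Gaussian families given a sigma-algebra *)

Section plane_rotation.
Context {R : comNzRingType} {I : finType}.
Implicit Types x y : I -> R.

Definition dot x y : R := \sum_i x i * y i.

(** Rotation in the plane of the coordinates [i] and [j]; it is applied both to
    vectors of coefficients and, pointwise, to families of random variables. *)
Definition givens (i j : I) (c s : R) x (k : I) : R :=
  if k == i then c * x i + s * x j
  else if k == j then c * x j - s * x i else x k.

Lemma dot_givens i j c s x y : i != j -> c ^+ 2 + s ^+ 2 = 1 ->
  dot (givens i j c s x) (givens i j c s y) = dot x y.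
Proof.
move=> ij cs; rewrite /dot (bigD1 i)//= (bigD1 j) 1?eq_sym//=.
rewrite [RHS](bigD1 i)//= [in RHS](bigD1 j) 1?eq_sym//= !addrA; congr (_ + _).
  rewrite /givens !eqxx eq_sym (negPf ij).
  transitivity ((c ^+ 2 + s ^+ 2) * (x i * y i + x j * y j)); first by ring.
  by rewrite cs mul1r.
by apply: eq_bigr => k /andP[/negPf ki /negPf kj]; rewrite /givens ki kj.
Qed.

End plane_rotation.

Section standard_given.
Local Open Scope ereal_scope.
Context d (T : measurableType d) (R : realType) (P : probability T R).
Notation N := (@normal_prob R 0 1).
Let RR := measurableTypeR R.
Variables (G : set (set T)) (I : finType).
Hypothesis Gm : G `<=` measurable.
Hypothesis GI : setI_closed G.
Hypothesis GT : G setT.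

(** Joint factorization of [G], [Z i], i in I, with standard normal marginals:
    the [Z i] are independent standard normal variables, jointly independent of
    [G].  Stated on events, it needs no measure on [R^I]. *)
Definition standard_given (Z : I -> T -> R) : Prop :=
  (forall i, measurable_fun setT (Z i)) /\
  forall D (B : I -> set R), G D -> (forall i, measurable (B i)) ->
    P (D `&` \big[setI/setT]_i (Z i @^-1` B i)) = P D * \prod_i N (B i).

(** Generates the information that is independent of [a.Z] when [Z] is
    standard Gaussian given [G]. *)
Definition orthogonal_events (Z : I -> T -> R) (a : I -> R) : set (set T) :=
  G `|` [set X | exists b, dot b a = 0%R /\ exists2 B : set R, measurable B &
    X = (fun w => dot b (Z^~ w)) @^-1` B].

Lemma measurable_preimageR (X : T -> R) (B : set R) :
  measurable_fun setT X -> measurable B -> measurable (X @^-1` B).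
Proof. by move=> mX mB; rewrite -[X in measurable X]setTI; exact: mX. Qed.

(** Freezing the event [E] that concerns [G] and the other coordinates, the law
    of [(Z i, Z j)] restricted to [E] agrees on rectangles with a multiple of
    the planar Gaussian, hence everywhere, hence it is invariant under
    rotation. *)
Lemma standard_given_givens Z i j (c s : R) : i != j -> c != 0%R ->
  (c ^+ 2 + s ^+ 2 = 1)%R -> standard_given Z ->
  standard_given (fun k w => givens i j c s (Z^~ w) k).
Proof.
move=> ij c0 cs [mZ ZE]; set Z' := fun k w => _.
have mZ' k : measurable_fun setT (Z' k).
  rewrite /Z' /givens; case: (k == i).
    by apply: measurable_funD; apply: measurable_funM.
  case: (k == j) => //.
  by apply: measurable_funB; apply: measurable_funM.
split => // D B GD mB.
set E := D `&` \big[setI/setT]_(k | (k != i) && (k != j)) (Z k @^-1` B k).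
have mE : measurable E.
  apply: measurableI; first exact: Gm.
  apply: bigsetI_measurable => k _; exact: measurable_preimageR.
set S : set (RR * RR) := [set z | B i (c * z.1 + s * z.2)%R /\ B j (c * z.2 - s * z.1)%R].
have splitB (X : I -> T -> R) (C : I -> set R) :
    (forall k, k != i -> k != j -> X k @^-1` C k = Z k @^-1` B k) ->
    D `&` \big[setI/setT]_k (X k @^-1` C k) =
    (X i @^-1` C i) `&` (X j @^-1` C j) `&` E.
  move=> h; rewrite (bigD1 i)//= (bigD1 j) 1?eq_sym//= /E.
  rewrite (eq_bigr (fun k => Z k @^-1` B k)); last by move=> k /andP[]; exact: h.
  by rewrite -[RHS]setIA setICA; congr (_ `&` _); rewrite setICA.
pose K := \prod_(k | (k != i) && (k != j)) N (B k).
have mpair : measurable_fun setT (fun w => (Z i w, Z j w) : RR * RR).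
  by apply: measurable_fun_pair; apply: mZ.
have rectE (A A' : set RR) : measurable A -> measurable A' ->
    P ((Z i @^-1` A) `&` (Z j @^-1` A') `&` E) = P D * (N A * (N A' * K)).
  move=> mA mA'.
  pose C k := if k == i then A else if k == j then A' else B k.
  have Ci : C i = A by rewrite /C eqxx.
  have Cj : C j = A' by rewrite /C eqxx eq_sym (negPf ij).
  have -> : Z i @^-1` A `&` Z j @^-1` A' `&` E = D `&` \big[setI/setT]_k (Z k @^-1` C k).
    rewrite splitB ?Ci ?Cj// => k /negPf ki /negPf kj.
    by rewrite /C ki kj.
  rewrite ZE//; last by move=> k; rewrite /C; case: ifP => // _; case: ifP.
  congr (_ * _); rewrite (bigD1 i)//= (bigD1 j) 1?eq_sym//= Ci Cj.
  congr (_ * (_ * _)); apply: eq_bigr => k /andP[/negPf ki /negPf kj].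
  by rewrite /C ki kj.
have NT : N setT = 1 by exact: probability_setT.
have PE : P E = P D * K.
  have := rectE setT setT measurableT measurableT.
  by rewrite !preimage_setT !setTI NT !mul1e.
(* The constant of proportionality r is the mass P E of the first measure. *)
pose m1 := image_measure (T2 := (RR * RR)%type) (mrestr P mE) mpair.
have PEfin : P E \is a fin_num by rewrite fin_num_measure.
pose r := NngNum (fine_ge0 (measure_ge0 P E)).
pose m2 := mscale r (N \x N).
have m12 (X : set (RR * RR)) : measurable X -> m1 X = m2 X.
  apply: eq_measure_rectangles.
    suff : P (setT `&` E) < +oo by [].
    by rewrite setTI ltey_eq PEfin.
  move=> A A' mA mA'.
  transitivity (P ((Z i @^-1` A) `&` (Z j @^-1` A') `&` E)); first by [].
  transitivity ((fine (P E))%:E * (N \x N) (A `*` A')); last by [].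
  rewrite product_measure1E// fineK// rectE// PE -muleA; congr (_ * _).
  by rewrite muleA muleC.
have mS : measurable S.
  rewrite (_ : S = (fun z : RR * RR => (c * z.1 + s * z.2)%R : RR) @^-1` B i `&`
    (fun z : RR * RR => (c * z.2 - s * z.1)%R : RR) @^-1` B j)//.
  apply: measurableI; rewrite -[X in measurable X]setTI.
    by apply: (measurable_funD (D := setT)) => //; apply: measurable_funM.
  by apply: (measurable_funB (D := setT)) => //; apply: measurable_funM.
have -> : D `&` \big[setI/setT]_k (Z' k @^-1` B k) =
    (fun w => (Z i w, Z j w)) @^-1` S `&` E.
  rewrite splitB; last first.
    by move=> k /negPf ki /negPf kj; rewrite /Z' /givens ki kj.
  congr (_ `&` _); apply/seteqP; split=> w;
    by rewrite /S/= /Z' /givens !eqxx eq_sym (negPf ij).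
transitivity (m1 S); first by [].
rewrite m12//; transitivity ((fine (P E))%:E * (N \x N) S); first by [].
rewrite product_normal_rot//; [|exact: mB|exact: mB].
rewrite fineK// PE (bigD1 i)//= (bigD1 j) 1?eq_sym//=.
by rewrite -muleA; congr (_ * _); rewrite muleC muleA.
Qed.


Lemma sigma_sub (C1 C2 : set (set T)) : C1 `<=` <<s C2 >> -> <<s C1 >> `<=` <<s C2 >>.
Proof. by move=> C12 X; apply; split => //; exact: smallest_sigma_algebra. Qed.

Lemma orthogonal_events_givens Z a i j (c s : R) : i != j ->
  (c ^+ 2 + s ^+ 2 = 1)%R ->
  orthogonal_events Z a `<=`
  orthogonal_events (fun k w => givens i j c s (Z^~ w) k) (givens i j c s a).
Proof.
move=> ij cs X [GX|[b [ba [B mB ->]]]]; first by left.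
right; exists (givens i j c s b); split; first by rewrite dot_givens.
exists B => //; rewrite /preimage; apply/seteqP.
by split=> w /=; rewrite dot_givens.
Qed.

(** When [a] is supported on [k], orthogonality to [a] means not involving
    [Z k], so the events concerned are generated by the pi-system of the
    intersections of an event of [G] and conditions on the other [Z i], for
    which independence from [Z k] is the definition. *)
Lemma standard_given_indep Z (a : I -> R) (k : I) (B : set R) :
  standard_given Z -> a k != 0%R -> (forall i, i != k -> a i = 0%R) ->
  measurable B ->
  forall E, <<s orthogonal_events Z a >> E -> P (Z k @^-1` B `&` E) = N B * P E.
Proof.
move=> [mZ ZE] ak a0 mB.
pose C : set (set T) := [set X | exists D, G D /\ exists2 B : I -> set R,
  forall i, measurable (B i) &
  X = D `&` \big[setI/setT]_(i | i != k) (Z i @^-1` B i)].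
have Cm : C `<=` measurable.
  move=> _ [D [GD [B' mB' ->]]]; apply: measurableI; first exact: Gm.
  by apply: bigsetI_measurable => i _; exact: measurable_preimageR.
have CI : setI_closed C.
  move=> _ _ [D1 [GD1 [B1 mB1 ->]]] [D2 [GD2 [B2 mB2 ->]]].
  exists (D1 `&` D2); split; first exact: GI.
  exists (fun i => B1 i `&` B2 i); first by move=> i; exact: measurableI.
  by rewrite setIACA -big_split/=; congr (_ `&` _); exact: eq_bigr.
have sub : orthogonal_events Z a `<=` <<s C >>.
  move=> X [GX|[b [ba [B' mB' ->]]]].
    apply: sub_sigma_algebra; exists X; split => //; exists (fun=> setT) => //.
    by rewrite big1 ?setIT// => i _; rewrite preimage_setT.
  have mZC i : i != k ->
      measurable_fun setT (Z i : g_sigma_algebraType C -> R).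
    move=> ik _ B2 mB2; rewrite setTI; apply: sub_sigma_algebra.
    exists setT; split => //; exists (fun j => if j == i then B2 else setT).
      by move=> j; case: ifP.
    rewrite setTI (bigD1 i)//= eqxx big1 ?setIT// => j /andP[_ /negPf ->].
    by rewrite preimage_setT.
  have bk : b k = 0%R.
    move: ba; rewrite /dot (bigD1 k)//= big1 ?addr0.
      by move/eqP; rewrite mulf_eq0 (negPf ak) orbF => /eqP.
    by move=> i ik; rewrite a0// mulr0.
  have mdot : measurable_fun setT
      ((fun w => dot b (Z^~ w)) : g_sigma_algebraType C -> R).
    apply: measurable_sum => i.
    have [->|ik] := eqVneq i k.
      by under eq_fun do rewrite bk mul0r; exact: measurable_cst.
    by apply: measurable_funM => //; exact: mZC.
  have := mdot measurableT B' mB'; rewrite setTI; exact.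
move=> E /(sigma_sub sub) CE.
pose m1 := mrestr P (measurable_preimageR (mZ k) mB).
pose nb := NngNum (fine_ge0 (measure_ge0 N B)).
pose m2 := mscale nb P.
have NB : (fine (N B))%:E = N B by rewrite fineK// fin_num_measure.
rewrite setIC; transitivity (m1 E); first by [].
transitivity (m2 E); last by rewrite -NB.
apply: (g_sigma_algebra_measure_unique C Cm (fun=> setT)) CE => //.
- move=> _; exists setT; split => //; exists (fun=> setT) => //.
  by rewrite big1 ?setIT// => i _; rewrite preimage_setT.
- by rewrite bigcup_const//; exists 0%N.
- move=> _ [D [GD [B' mB' ->]]].
  transitivity (P (D `&` \big[setI/setT]_i
      (Z i @^-1` (if i == k then B else B' i)))).
    rewrite [in RHS](bigD1 k)//= eqxx.
    rewrite [in RHS](eq_bigr (fun i => Z i @^-1` B' i)); last by move=> i /negPf ->.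
    by rewrite [in RHS]setICA [in RHS]setIC.
  rewrite ZE//; last by move=> i; case: ifP.
  transitivity ((fine (N B))%:E *
    P (D `&` \big[setI/setT]_(i | i != k) (Z i @^-1` B' i))); last by [].
  rewrite NB (bigD1 k)//= eqxx muleCA; congr (_ * _).
  transitivity (P (D `&` \big[setI/setT]_i
      (Z i @^-1` (if i == k then setT else B' i)))); last first.
    congr (P (_ `&` _)); rewrite (bigD1 k)//= eqxx preimage_setT setTI.
    by apply: eq_bigr => i /negPf ->.
  rewrite ZE//; last by move=> i; case: ifP.
  rewrite [in RHS](bigD1 k)//= eqxx probability_setT mul1e; congr (_ * _).
  by apply: eq_bigr => i /negPf ->.
- move=> _; suff : P (setT `&` Z k @^-1` B) < +oo by [].
  by rewrite setTI ltey_eq fin_num_measure//; exact: measurable_preimageR.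
Qed.

End standard_given.

(** * A Pythagorean identity for Gaussian families *)

Section independent_noise.
Local Open Scope ereal_scope.
Context d (T : measurableType d) (R : realType) (P : probability T R).
Notation N := (@normal_prob R 0 1).
Let RR := measurableTypeR R.

(** [(X, h)] and [(- X, h)] have the same law, so [x X + h] and [x X - h] have
    the same second moment; average the two by the parallelogram law. *)
Lemma indep_normal_second_moment (X h : T -> R) (x : R) :
  measurable_fun setT X -> measurable_fun setT h ->
  (forall A B, measurable A -> measurable B ->
    P (X @^-1` A `&` h @^-1` B) = N A * P (h @^-1` B)) ->
  \int[P]_w ((x * X w + h w) ^+ 2)%:E = (x ^+ 2)%:E + \int[P]_w (h w ^+ 2)%:E.
Proof.
move=> mX mh XhE.
have mNX : measurable_fun setT (fun w => - X w)%R by exact: measurableT_comp.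
have mp1 : measurable_fun setT (fun w => (X w, h w) : RR * RR).
  by apply: measurable_fun_pair; [exact: mX|exact: mh].
have mp2 : measurable_fun setT (fun w => (- X w, h w)%R : RR * RR).
  by apply: measurable_fun_pair; [exact: mNX|exact: mh].
pose m1 := image_measure (T2 := (RR * RR)%type) P mp1.
pose m2 := image_measure (T2 := (RR * RR)%type) P mp2.
have m12 (S : set (RR * RR)) : measurable S -> m1 S = m2 S.
  apply: eq_measure_rectangles.
    suff : P setT < +oo by [].
    by rewrite probability_setT ltry.
  move=> A B mA mB.
  transitivity (P (X @^-1` A `&` h @^-1` B)); first by [].
  transitivity (P (X @^-1` (-%R @^-1` A) `&` h @^-1` B)); last by [].
  rewrite !XhE//; last exact: measurable_preimageR.
  by rewrite normal_opp.
have msq (f : T -> R) : measurable_fun setT f ->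
    measurable_fun setT (fun w => (f w ^+ 2)%:E).
  by move=> mf; apply/measurable_EFinP; exact: measurable_funX.
pose J := \int[P]_w ((x * X w + h w) ^+ 2)%:E.
have JN : J = \int[P]_w ((x * X w - h w) ^+ 2)%:E.
  pose g (z : RR * RR) : \bar R := ((x * z.1 + z.2) ^+ 2)%:E.
  have mg : measurable_fun setT g.
    apply/measurable_EFinP; apply: measurable_funX.
    apply: (measurable_funD (D := setT)); last exact: (@measurable_snd _ _ RR RR).
    apply: measurable_funM => //; exact: (@measurable_fst _ _ RR RR).
  have g0 z : 0 <= g z by rewrite lee_fin sqr_ge0.
  transitivity (\int[m1]_z g z); first by rewrite ge0_integral_image_measure.
  transitivity (\int[m2]_z g z).
    by apply: eq_measure_integral => S mS _; exact: m12.
  rewrite ge0_integral_image_measure//; apply: eq_integral => w _.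
  by rewrite /g/= mulrN -sqrrN opprD opprK.
have X2 : \int[P]_w (X w ^+ 2)%:E = 1.
  pose m3 := image_measure (T2 := RR) P mX.
  rewrite -(@normal_second_moment R).
  transitivity (\int[m3]_y (y ^+ 2)%:E).
    rewrite ge0_integral_image_measure//.
      by apply/measurable_EFinP; exact: measurable_funX.
    by move=> y; rewrite lee_fin sqr_ge0.
  apply: eq_measure_integral => A mA _.
  have := XhE A setT mA measurableT.
  by rewrite preimage_setT setIT probability_setT mule1.
have JJ : J + J = 2%:E * ((x ^+ 2)%:E + \int[P]_w (h w ^+ 2)%:E).
  rewrite {2}JN -ge0_integralD//; last 4 first.
  - by move=> w _; rewrite lee_fin sqr_ge0.
  - by apply: msq; apply: measurable_funD => //; exact: measurable_funM.
  - by move=> w _; rewrite lee_fin sqr_ge0.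
  - by apply: msq; apply: measurable_funB => //; exact: measurable_funM.
  rewrite -[X in X + _]mule1 -X2 -ge0_integralZl_EFin ?sqr_ge0//; last 2 first.
  - by move=> w _; rewrite lee_fin sqr_ge0.
  - exact: msq.
  rewrite -ge0_integralD//; last 4 first.
  - by move=> w _; rewrite -EFinM lee_fin mulr_ge0 ?sqr_ge0.
  - by apply: measurable_funeM; exact: msq.
  - by move=> w _; rewrite lee_fin sqr_ge0.
  - exact: msq.
  rewrite -ge0_integralZl_EFin//; last 2 first.
  - by move=> w _; rewrite adde_ge0 ?mule_ge0 ?lee_fin ?sqr_ge0.
  - by apply: emeasurable_funD; [apply: measurable_funeM|]; exact: msq.
  apply: eq_integral => w _; rewrite -!EFinM -!EFinD -?EFinM; congr EFin; ring.
transitivity (2^-1%:E * (J + J)).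
  have J0 : 0 <= J by apply: integral_ge0 => w _; rewrite lee_fin sqr_ge0.
  rewrite -mule2n -[J *+ 2]mule_natl muleA -EFinM mulVf ?mul1e//.
by rewrite JJ muleA -EFinM mulVf ?mul1e.
Qed.

Variables (G : set (set T)) (I : finType).
Hypothesis Gm : G `<=` measurable.
Hypothesis GI : setI_closed G.
Hypothesis GT : G setT.

Lemma orthogonal_events_measurable (Z : I -> T -> R) a :
  (forall i, measurable_fun setT (Z i)) ->
  <<s orthogonal_events G Z a >> `<=` measurable.
Proof.
move=> mZ; apply: smallest_sub; first exact: sigma_algebra_measurable.
move=> X [/Gm//|[b [_ [B mB ->]]]]; apply: measurable_preimageR => //.
by apply: measurable_sum => i; exact: measurable_funM.
Qed.

(** Induction on the number of nonzero coordinates of [a]: while there are two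
    of them, a rotation in their plane kills one and changes neither the inner
    products nor the law of the family. *)
Theorem orthogonal_noise_second_moment (Z : I -> T -> R) (a : I -> R)
    (h : T -> R) :
  standard_given P G Z ->
  (forall B, measurable B -> <<s orthogonal_events G Z a >> (h @^-1` B)) ->
  \int[P]_w ((dot a (Z^~ w) + h w) ^+ 2)%:E
  = (dot a a)%:E + \int[P]_w (h w ^+ 2)%:E.
Proof.
have [m] := ubnP #|[pred i | a i != 0%R]|.
elim: m => // m IH in Z a *; rewrite ltnS => am SZ hB.
have mZ := SZ.1.
have [[i [j [ij ai aj]]]|] := pselect (exists i j, [/\ i != j, a i != 0%R & a j != 0%R]).
  (* The rotation that sends (a i, a j) to (r, 0). *)
  pose r := Num.sqrt (a i ^+ 2 + a j ^+ 2).
  have r2 : (r ^+ 2 = a i ^+ 2 + a j ^+ 2)%R.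
    by rewrite sqr_sqrtr// addr_ge0 ?sqr_ge0.
  have r0 : r != 0%R.
    by rewrite sqrtr_eq0 -ltNge ltr_pwDl ?sqr_ge0// exprn_even_gt0.
  pose c := (a i / r)%R; pose s := (a j / r)%R.
  have cs : (c ^+ 2 + s ^+ 2 = 1)%R.
    by rewrite !exprMn -mulrDl -r2 exprVn divff// expf_eq0.
  have c0 : c != 0%R by rewrite mulf_neq0// invr_eq0.
  pose Z' k w := givens i j c s (Z^~ w) k.
  pose a' := givens i j c s a.
  have a'j : a' j = 0%R.
    by rewrite /a' /givens eq_sym (negPf ij) eqxx /c /s; ring.
  have := IH Z' a'.
  rewrite /a' dot_givens//= => <-.
  - by apply: eq_integral => w _; rewrite dot_givens.
  - apply: leq_trans am; apply: proper_card.
    apply/properP; split; last by exists j; rewrite inE ?aj// -/a' a'j eqxx.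
    apply/fintype.subsetP => k; rewrite !inE /a' /givens.
    by have [->//|_] := eqVneq k i; have [->//|] := eqVneq k j.
  - exact: standard_given_givens.
  - move=> B mB; apply: (sigma_sub _ (hB _ mB)) => X XZ.
    by apply: sub_sigma_algebra; exact: orthogonal_events_givens.
move=> /forallNP a1.
have mh : measurable_fun setT h.
  move=> _ B mB; rewrite setTI.
  by apply: (orthogonal_events_measurable mZ); exact: hB.
have [[k ak]|/forallNP a0] := pselect (exists k, a k != 0%R); last first.
  have {}a0 i : a i = 0%R by apply/eqP/negPn/negP; exact: a0.
  have d0 (y : I -> R) : dot a y = 0%R by rewrite /dot big1// => i _; rewrite a0 mul0r.
  by rewrite d0 add0e; apply: eq_integral => w _; rewrite d0 add0r.
have a0 i : i != k -> a i = 0%R.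
  move=> ik; apply/eqP/negPn/negP => ai; apply: (a1 i); exists k.
  by split.
have dE y : dot a y = (a k * y k)%R.
  by rewrite /dot (bigD1 k)//= big1 ?addr0// => i ik; rewrite a0 ?mul0r.
rewrite dE -expr2 -(@indep_normal_second_moment (Z k))//.
  by apply: eq_integral => w _; rewrite dE.
move=> A B mA mB.
by rewrite (standard_given_indep Gm GI GT SZ ak)//; exact: hB.
Qed.

End independent_noise.

(** * Covariance updates as quadratic forms *)

Section quadratic_form.
Context {R : realFieldType} {n : nat}.
Implicit Types (S : 'M[R]_n) (u : 'rV[R]_n).

Definition quad S u : R := (u *m S *m u^T) 0 0.

Lemma quadD S1 S2 u : quad (S1 + S2) u = quad S1 u + quad S2 u.
Proof. by rewrite /quad mulmxDr mulmxDl mxE. Qed.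

Lemma quadZ k S u : quad (k *: S) u = k * quad S u.
Proof. by rewrite /quad -scalemxAr -scalemxAl mxE. Qed.

Lemma quad0 u : quad 0 u = 0.
Proof. by rewrite /quad mulmx0 mul0mx mxE. Qed.

Lemma quad_scalar (k : R) u : quad k%:M u = k * quad 1%:M u.
Proof. by rewrite -quadZ scale_scalar_mx mulr1. Qed.

Lemma quad_delta S i : quad S (delta_mx 0 i) = S i i.
Proof. by rewrite /quad -rowE trmx_delta -colE !mxE. Qed.

Lemma quad1E u : quad 1%:M u = \sum_i u 0 i ^+ 2.
Proof. by rewrite /quad mulmx1 mxE; apply: eq_bigr => i _; rewrite mxE expr2. Qed.

Lemma quad1_ge0 u : 0 <= quad 1%:M u.
Proof. by rewrite quad1E sumr_ge0// => i _; rewrite sqr_ge0. Qed.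

Lemma quad_le_norm S u : quad S u <= (\sum_i \sum_j `|S i j|) * quad 1%:M u.
Proof.
have -> : quad S u = \sum_i \sum_j u 0 i * S i j * u 0 j.
  rewrite /quad mxE exchange_big; apply: eq_bigr => j _ /=.
  by rewrite !mxE mulr_suml.
rewrite mulr_suml; apply: ler_sum => i _; rewrite mulr_suml.
apply: ler_sum => j _; rewrite (le_trans (ler_norm _))// !normrM mulrAC mulrC.
rewrite ler_wpM2l// quad1E.
have ij k : u 0 k ^+ 2 <= \sum_i u 0 i ^+ 2.
  by rewrite (bigD1 k)//= lerDl sumr_ge0// => l _; rewrite sqr_ge0.
have := sqr_ge0 (`|u 0 i| - `|u 0 j|).
rewrite sqrrB !real_normK ?num_real// => h.
have := ij i; have := ij j; move: h; rewrite -mulr_natl.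
set a := `|_|; set b := `|_|; set x := u 0 i ^+ 2; set y := u 0 j ^+ 2.
by set z := \sum_i _; nra.
Qed.

End quadratic_form.

Lemma quad_conj (R : realFieldType) (n k : nat) (B : 'M[R]_(n, k)) (S : 'M[R]_k)
  (u : 'rV[R]_n) : quad (B *m S *m B^T) u = quad S (u *m B).
Proof. by rewrite /quad trmx_mul !mulmxA. Qed.

Lemma quad_gram_ge0 (R : realFieldType) (n k : nat) (B : 'M[R]_(n, k))
  (u : 'rV[R]_n) : 0 <= quad (B *m B^T) u.
Proof. by rewrite -[B in B *m _]mulmx1 quad_conj quad1_ge0. Qed.

Section riccati.
Context {R : realType} (n m : nat) (A : 'M[R]_n) (C : 'M[R]_(m, n)).
Variables (sigma_w sigma_v : R).
Hypotheses (sigma_w_gt0 : 0 < sigma_w) (sigma_v_gt0 : 0 < sigma_v).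
Notation gain := (kalman_gain C sigma_v).
Notation fcov := (filter_cov C sigma_v).

Definition innovation_cov (S : 'M[R]_n) : 'M[R]_m :=
  C *m S *m C^T + (sigma_v ^+ 2)%:M.

Definition covariance (S : 'M[R]_n) : Prop :=
  S^T = S /\ forall u, 0 <= quad S u.

(** Error covariance after a measurement is used with an arbitrary gain [L]. *)
Definition measurement_update (L : 'M[R]_(n, m)) (S : 'M[R]_n) : 'M[R]_n :=
  (1%:M - L *m C) *m S *m (1%:M - L *m C)^T + (sigma_v ^+ 2) *: (L *m L^T).

Definition time_update (S : 'M[R]_n) : 'M[R]_n :=
  A *m S *m A^T + (sigma_w ^+ 2)%:M.

Lemma innovation_cov_unit S : covariance S -> innovation_cov S \in unitmx.
Proof.
move=> [_ S0]; rewrite -row_free_unit -kermx_eq0.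
apply/rowV0P => u /sub_kermxP uM.
have : quad (innovation_cov S) u = 0 by rewrite /quad uM mul0mx mxE.
rewrite quadD quad_conj quad_scalar => h.
have : quad 1%:M u = 0.
  apply/eqP; rewrite eq_le quad1_ge0 andbT.
  have s2 : 0 < sigma_v ^+ 2 by rewrite exprn_gt0.
  have := S0 (u *m C); have := quad1_ge0 u; nra.
rewrite quad1E => /eqP; rewrite psumr_eq0; last by move=> i _; rewrite sqr_ge0.
move=> /allP u0; apply/rowP => i; rewrite mxE.
by apply/eqP; rewrite -sqrf_eq0; exact: (implyP (u0 i (mem_index_enum _))).
Qed.

Lemma gain_innovation S : covariance S -> gain S *m innovation_cov S = S *m C^T.
Proof. by move=> cS; rewrite /kalman_gain mulmxKV// innovation_cov_unit. Qed.

Lemma innovation_cov_sym S : covariance S -> (innovation_cov S)^T = innovation_cov S.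
Proof.
by move=> [ST _]; rewrite /innovation_cov linearD/= tr_scalar_mx !trmx_mul ST trmxK mulmxA.
Qed.

(** Completing the square in the gain: the Kalman gain is optimal, and
    [filter_cov] is the minimum. *)
Lemma measurement_updateE S L : covariance S ->
  measurement_update L S =
  fcov S + (L - gain S) *m innovation_cov S *m (L - gain S)^T.
Proof.
move=> cS; have gM := gain_innovation cS.
have gMT : innovation_cov S *m (gain S)^T = C *m S.
  by rewrite -[LHS]trmxK trmx_mul trmxK innovation_cov_sym// gM trmx_mul trmxK cS.1.
set M := innovation_cov S in gM gMT *; set g := gain S in gM gMT *.
have e1 : (L - g) *m M *m (L - g)^T =
    (L *m M *m L^T - S *m C^T *m L^T) - (L *m C *m S - g *m C *m S).
  rewrite [(L - g)^T]linearB/= mulmxBr !mulmxBl.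
  by rewrite -!(mulmxA _ M g^T) gMT gM !mulmxA.
have e2 : L *m M *m L^T = L *m C *m S *m C^T *m L^T + (sigma_v ^+ 2) *: (L *m L^T).
  by rewrite /M /innovation_cov mulmxDr mulmxDl mul_mx_scalar -scalemxAl !mulmxA.
have e3 : (1%:M - L *m C) *m S *m (1%:M - L *m C)^T =
    S - L *m C *m S - (S *m C^T *m L^T - L *m C *m S *m C^T *m L^T).
  rewrite [(1%:M - L *m C)^T]linearB/= trmx1 trmx_mul mulmxBr mulmx1.
  by rewrite mulmxBl mul1mx mulmxBl !mulmxA.
rewrite e1 e2 /measurement_update e3 /filter_cov -/g.
move: (L *m C *m S *m C^T *m L^T) (L *m C *m S) (S *m C^T *m L^T).
move: (g *m C *m S) (_ *: (L *m L^T)) => a b c e f.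
by apply/matrixP => i k; rewrite !mxE; ring.
Qed.

Lemma fcovE S : covariance S -> fcov S = measurement_update (gain S) S.
Proof. by move=> cS; rewrite measurement_updateE// subrr !mul0mx addr0. Qed.

Lemma innovation_cov_ge0 S u : covariance S -> 0 <= quad (innovation_cov S) u.
Proof.
move=> [_ S0]; rewrite quadD quad_conj quad_scalar addr_ge0//.
by rewrite mulr_ge0 ?sqr_ge0 ?quad1_ge0.
Qed.

Lemma fcov_le_measurement_update S L u : covariance S ->
  quad (fcov S) u <= quad (measurement_update L S) u.
Proof.
move=> cS; rewrite (measurement_updateE L cS) [leRHS]quadD lerDl quad_conj.
exact: innovation_cov_ge0.
Qed.

Lemma measurement_update_cov S L : covariance S -> covariance (measurement_update L S).
Proof.
move=> [ST S0]; split=> [|u].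
  rewrite /measurement_update linearD linearZ/= !trmx_mul !trmxK ST.
  by rewrite -mulmxA.
rewrite quadD quadZ quad_conj addr_ge0// mulr_ge0 ?sqr_ge0//.
exact: quad_gram_ge0.
Qed.

Lemma fcov_cov S : covariance S -> covariance (fcov S).
Proof. by move=> cS; rewrite fcovE//; exact: measurement_update_cov. Qed.

Lemma time_update_cov S : covariance S -> covariance (time_update S).
Proof.
move=> [ST S0]; split=> [|u].
  by rewrite /time_update linearD/= tr_scalar_mx !trmx_mul trmxK ST mulmxA.
by rewrite quadD quad_conj quad_scalar addr_ge0// mulr_ge0 ?sqr_ge0 ?quad1_ge0.
Qed.

Lemma quad_measurement_update L S u : quad (measurement_update L S) u =
  quad S (u *m (1%:M - L *m C)) + sigma_v ^+ 2 * quad (L *m L^T) u.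
Proof. by rewrite quadD quadZ quad_conj. Qed.

Lemma quad_time_update S u :
  quad (time_update S) u = quad S (u *m A) + sigma_w ^+ 2 * quad 1%:M u.
Proof. by rewrite quadD quad_conj quad_scalar. Qed.

(** [filter_cov] is the minimum over gains of an affine function of the
    covariance, with nonnegative constant term. *)
Lemma fcov_lower (theta : R) S S' : 0 <= theta <= 1 ->
  covariance S -> covariance S' ->
  (forall u, theta * quad S u <= quad S' u) ->
  forall u, theta * quad (fcov S) u <= quad (fcov S') u.
Proof.
move=> /andP[t0 t1] cS cS' SS' u; rewrite (fcovE cS') quad_measurement_update.
have := fcov_le_measurement_update (gain S') u cS.
rewrite quad_measurement_update.
have := SS' (u *m (1%:M - gain S' *m C)).
move=> h1 h2.
have := ler_wpM2l t0 h2; rewrite mulrDr => /le_trans; apply; apply: lerD => //.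
by rewrite ler_piMl// mulr_ge0 ?sqr_ge0 ?quad_gram_ge0.
Qed.

Lemma measurement_update_upper (tau : R) L S S' : 1 <= tau ->
  (forall u, quad S' u <= tau * quad S u) ->
  forall u, quad (measurement_update L S') u <=
            tau * quad (measurement_update L S) u.
Proof.
move=> t1 SS' u; rewrite !quad_measurement_update mulrDr lerD//.
by rewrite ler_peMl// mulr_ge0 ?sqr_ge0 ?quad_gram_ge0.
Qed.

Variable Ps : 'M[R]_n.
Hypothesis cPs : covariance Ps.
Hypothesis PsE : Ps = time_update (fcov Ps).

(** The number [1 - sigma_w^2 / lambda], where [lambda I] dominates [Ps].  The
    term [sigma_w^2] in the denominator keeps [lambda] positive even when [n = 0]. *)
Definition contraction : R := 
  1 - sigma_w ^+ 2 / (sigma_w ^+ 2 + \sum_i \sum_j `|Ps i j|).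
Notation rho := contraction.

Let lam_ge0 : 0 <= \sum_i \sum_j `|Ps i j|.
Proof. by apply: sumr_ge0 => i _; apply: sumr_ge0. Qed.

Let sw2 : 0 < sigma_w ^+ 2. Proof. by rewrite exprn_gt0. Qed.

Lemma contraction_itv : 0 <= rho < 1.
Proof.
rewrite subr_ge0 ler_pdivrMr ?mul1r ?lerDl ?lam_ge0 ?ltr_pwDl//=.
by rewrite ltrBlDr ltrDl divr_gt0// ltr_pwDl.
Qed.

(** The process noise restores a fraction [1 - rho] of [Ps] at each step, which
    is the source of the geometric rate. *)
Lemma contraction_noise u : (1 - rho) * quad Ps u <= sigma_w ^+ 2 * quad 1%:M u.
Proof.
rewrite /contraction opprB addrC subrK mulrAC ler_pdivrMr ?ltr_pwDl//.
rewrite -[leRHS]mulrA ler_pM2l//.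
apply: le_trans (quad_le_norm Ps u) _; rewrite mulrC ler_wpM2l ?quad1_ge0//.
by rewrite lerDr ltW.
Qed.

Lemma noise_le_Ps u : sigma_w ^+ 2 * quad 1%:M u <= quad Ps u.
Proof.
rewrite PsE quad_time_update lerDr.
by have [_] := fcov_cov cPs; apply.
Qed.

(** Covariance of the Kalman filter when the initial state is known. *)
Fixpoint riccati (t : nat) : 'M[R]_n :=
  if t is t'.+1 then time_update (fcov (riccati t')) else 0.

Lemma riccati_cov t : covariance (riccati t).
Proof.
elim: t => [|t IH] /=; last exact/time_update_cov/fcov_cov.
by split=> [|u]; rewrite ?trmx0// quad0.
Qed.

(** If [theta Ps <= S_t], applying one step gives
    [theta (Ps - sigma_w^2 I) + sigma_w^2 I <= S_(t+1)], and
    [sigma_w^2 I >= (1 - rho) Ps]. *)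
Lemma riccati_lower t u : (1 - rho ^+ t) * quad Ps u <= quad (riccati t) u.
Proof.
have /andP[r0 r1] := contraction_itv.
elim: t u => [|t IH] u; first by rewrite expr0 subrr mul0r quad0.
have rt1 : 0 <= 1 - rho ^+ t <= 1.
  by rewrite subr_ge0 gerBl exprn_ge0 ?exprn_ile1// ltW.
have /= h := fcov_lower rt1 cPs (riccati_cov t) IH (u *m A).
rewrite quad_time_update.
have := quad_time_update (fcov Ps) u; rewrite -PsE => e.
have := contraction_noise u => k.
have rt : 0 <= rho ^+ t by rewrite exprn_ge0.
move: h k e rt; rewrite (exprS rho); set q := quad Ps u; set f := quad (fcov Ps) _.
set z := sigma_w ^+ 2 * _; set g := quad (fcov (riccati t)) _; set r := rho ^+ t.
set a := rho => h k e rt; rewrite e in k *.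
have := ler_wpM2l rt k; lra.
Qed.

Lemma fcov_riccati_lower t u :
  (1 - rho ^+ t) * quad (fcov Ps) u <= quad (fcov (riccati t)) u.
Proof.
have /andP[r0 r1] := contraction_itv.
apply: fcov_lower => //; [|exact: riccati_cov|exact: riccati_lower].
by rewrite subr_ge0 gerBl exprn_ge0 ?exprn_ile1// ltW.
Qed.

Variable c0 : R.
Hypothesis c0_ge0 : 0 <= c0.

(** Covariance of the observer with the constant gain of [Ps], with initial
    covariance [c0 I]. *)
Fixpoint steady_gain_cov (t : nat) : 'M[R]_n :=
  if t is t'.+1
  then time_update (measurement_update (gain Ps) (steady_gain_cov t'))
  else c0%:M.

Lemma steady_gain_upper t u :
  quad (steady_gain_cov t) u <= (1 + c0 / sigma_w ^+ 2 * rho ^+ t) * quad Ps u.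
Proof.
have /andP[r0 r1] := contraction_itv.
elim: t u => [|t IH] u /=.
  rewrite expr0 mulr1 quad_scalar mulrDl mul1r -[leLHS]add0r lerD//.
    by case: cPs.
  rewrite -mulrA ler_wpM2l// mulrC ler_pdivlMr// mulrC.
  exact: noise_le_Ps.
have d0 : 0 <= c0 / sigma_w ^+ 2 * rho ^+ t.
  by rewrite !mulr_ge0 ?invr_ge0 ?exprn_ge0// ltW.
have t1 : 1 <= 1 + c0 / sigma_w ^+ 2 * rho ^+ t by rewrite lerDl.
have h := measurement_update_upper (gain Ps) t1 IH (u *m A).
move: h; rewrite -fcovE// => h; rewrite quad_time_update (exprS rho) (mulrCA (c0 / _)).
have := quad_time_update (fcov Ps) u; rewrite -PsE => e.
have := contraction_noise u => k.
move: h k e d0; set q := quad Ps u; set f := quad (fcov Ps) _.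
set z := sigma_w ^+ 2 * quad _ _; set g := quad (measurement_update _ _) _.
set r := c0 / _ * _; set a := rho => h k e rt; rewrite e in k *.
have := ler_wpM2l rt k; lra.
Qed.

Lemma fcov_steady_gain_upper t u :
  quad (measurement_update (gain Ps) (steady_gain_cov t)) u
  <= (1 + c0 / sigma_w ^+ 2 * rho ^+ t) * quad (fcov Ps) u.
Proof.
have /andP[r0 r1] := contraction_itv.
rewrite (fcovE cPs); apply: measurement_update_upper.
  by rewrite lerDl !mulr_ge0 ?invr_ge0 ?exprn_ge0// ltW.
exact: steady_gain_upper.
Qed.

End riccati.

(** * Error coefficients of linear filters *)

Lemma mulmx_tr_eq0 (R : comPzRingType) (a b k : nat) (B : 'M[R]_(a, k))
  (D : 'M[R]_(b, k)) : B *m D^T = 0 -> D *m B^T = 0.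
Proof. by move=> h; rewrite -[LHS]trmxK trmx_mul trmxK h trmx0. Qed.

Section error_coefficients.
Context {R : realType} (n m N H : nat) (A : 'M[R]_n) (C : 'M[R]_(m, n)).
Variables (sigma_w sigma_v : R).
Hypotheses (sigma_w_gt0 : 0 < sigma_w) (sigma_v_gt0 : 0 < sigma_v).
Variables (W : nat -> 'M[R]_(n, N)) (V : nat -> 'M[R]_(m, N)).

(** [W t] and [V t] are the coefficients of the process and measurement noise at
    time [t] on [N] orthonormal coordinates, of which there are enough only for
    times before [H]. *)
Definition white_coefficients : Prop :=
  forall s t, (s < H)%N -> (t < H)%N ->
  [/\ W s *m (W t)^T = if s == t then (sigma_w ^+ 2)%:M else 0,
      V s *m (V t)^T = if s == t then (sigma_v ^+ 2)%:M else 0,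
      V s *m (W t)^T = 0 & W s *m (V t)^T = 0].
Hypothesis white : white_coefficients.

Implicit Type L : nat -> 'M[R]_(n, m).

(** Coefficients, on the noise coordinates, of the prediction error of the
    observer with gains [L]. *)
Fixpoint err_coef L (t : nat) : 'M[R]_(n, N) :=
  if t is t'.+1
  then A *m (err_coef L t' - L t' *m (C *m err_coef L t' + V t')) + W t' else 0.

Definition ferr_coef L t := err_coef L t - L t *m (C *m err_coef L t + V t).

(** The zero gain ignores the outputs, so the error is the state itself. *)
Definition xcoef := err_coef (fun=> 0).
Definition ycoef t := C *m xcoef t + V t.

Lemma xcoefS t : xcoef t.+1 = A *m xcoef t + W t.
Proof. by rewrite /xcoef /= mul0mx subr0. Qed.

Lemma ferrE L t : ferr_coef L t = (1%:M - L t *m C) *m err_coef L t - L t *m V t.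
Proof.
by rewrite /ferr_coef mulmxDr mulmxBl mul1mx opprD addrA mulmxA.
Qed.

Lemma ferr_mulmx L t k (D : 'M[R]_(N, k)) :
  ferr_coef L t *m D = (1%:M - L t *m C) *m (err_coef L t *m D) - L t *m (V t *m D).
Proof. by rewrite ferrE mulmxBl -(mulmxA _ _ D) -(mulmxA (L t)). Qed.

(** The error at time [t] involves only the noise before [t]. *)
Lemma err_future L t s : (t <= s)%N -> (s < H)%N ->
  err_coef L t *m (W s)^T = 0 /\ err_coef L t *m (V s)^T = 0.
Proof.
elim: t => [|t IH] /= ts sH; first by rewrite !mul0mx.
have tH : (t < H)%N by apply: leq_trans sH; exact: ltnW.
have [eW eV] := IH (ltnW ts) sH.
have [WW VV VW WV] := white tH sH.
have ts' : (t == s) = false by rewrite ltn_eqF.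
have fW : ferr_coef L t *m (W s)^T = 0.
  by rewrite ferr_mulmx eW VW !mulmx0 subr0.
have fV : ferr_coef L t *m (V s)^T = 0.
  by rewrite ferr_mulmx eV VV ts' !mulmx0 subr0.
rewrite -/(ferr_coef L t) !mulmxDl -!(mulmxA A) fW fV WW WV ts'.
by rewrite !mulmx0 !addr0.
Qed.

Lemma ferr_gram L t : (t < H)%N ->
  ferr_coef L t *m (ferr_coef L t)^T =
  measurement_update C sigma_v (L t) (err_coef L t *m (err_coef L t)^T).
Proof.
move=> tH; have [eW eV] := err_future L (leqnn t) tH.
have [_ VV _ _] := white tH tH.
have Ve : V t *m (err_coef L t)^T = 0.
  exact: mulmx_tr_eq0 eV.
rewrite ferrE /measurement_update; move: (1%:M - L t *m C) => B.
rewrite [(_ - _)^T]linearB/= mulmxBr !mulmxBl !trmx_mul !mulmxA.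
rewrite -(mulmxA B (err_coef L t) (V t)^T) eV.
rewrite -(mulmxA (L t) (V t) (err_coef L t)^T) Ve -(mulmxA (L t) (V t) (V t)^T) VV eqxx.
by rewrite !(mulmx0, mul0mx) subr0 sub0r opprK mul_mx_scalar scalemxAl.
Qed.

Lemma err_gram L t : (t < H)%N ->
  err_coef L t.+1 *m (err_coef L t.+1)^T =
  time_update A sigma_w (ferr_coef L t *m (ferr_coef L t)^T).
Proof.
move=> tH; have [eW _] := err_future L (leqnn t) tH.
have [WW _ VW _] := white tH tH.
have fW : ferr_coef L t *m (W t)^T = 0.
  by rewrite ferr_mulmx eW VW !mulmx0 subr0.
have Wf : W t *m (ferr_coef L t)^T = 0.
  exact: mulmx_tr_eq0 fW.
rewrite /= -/(ferr_coef L t) /time_update.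
move: (ferr_coef L t) fW Wf => f fW Wf.
rewrite [(_ + _)^T]linearD/= trmx_mul mulmxDr !mulmxDl.
rewrite !mulmxA -(mulmxA A f (W t)^T) fW Wf WW eqxx.
by rewrite mul0mx addr0 mulmx0 add0r.
Qed.

Notation riccati := (riccati A C sigma_w sigma_v).
Definition kgain t := kalman_gain C sigma_v (riccati t).
Notation kerr := (err_coef kgain).
Notation kferr := (ferr_coef kgain).

Lemma kalman_gram t : (t <= H)%N -> kerr t *m (kerr t)^T = riccati t.
Proof.
elim: t => [|t IH] tH; first by rewrite mul0mx.
rewrite err_gram// ferr_gram// IH; last exact: ltnW.
rewrite -fcovE//; exact: riccati_cov.
Qed.

Lemma kalman_fgram t : (t < H)%N ->
  kferr t *m (kferr t)^T = filter_cov C sigma_v (riccati t).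
Proof.
move=> tH; rewrite ferr_gram// kalman_gram 1?ltnW// -fcovE//.
exact: riccati_cov.
Qed.

Lemma kferr_cross t : (t < H)%N -> kerr t *m (xcoef t)^T = riccati t ->
  kferr t *m (xcoef t)^T = filter_cov C sigma_v (riccati t).
Proof.
move=> tH h; rewrite ferr_mulmx h.
have [_ xV] := err_future (fun=> 0) (leqnn t) tH.
have -> : V t *m (xcoef t)^T = 0.
  exact: mulmx_tr_eq0 xV.
by rewrite mulmx0 subr0 /filter_cov mulmxBl mul1mx.
Qed.

(** The Kalman error is orthogonal to the estimate, so its products with the
    state and with itself agree. *)
Lemma kerr_cross t : (t <= H)%N -> kerr t *m (xcoef t)^T = riccati t.
Proof.
elim: t => [|t IH] tH; first by rewrite mul0mx.
have [kW kV] := err_future kgain (leqnn t) tH.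
have [xW _] := err_future (fun=> 0) (leqnn t) tH.
have [WW _ VW _] := white tH tH.
have fW : kferr t *m (W t)^T = 0.
  by rewrite ferr_mulmx kW VW !mulmx0 subr0.
have Wx : W t *m (xcoef t)^T = 0.
  exact: mulmx_tr_eq0 xW.
have fx := kferr_cross tH (IH (ltnW tH)).
rewrite xcoefS /= -/(kferr t) /time_update.
move: (kferr t) fW fx => f fW fx.
rewrite [(_ + _)^T]linearD/= trmx_mul mulmxDr !mulmxDl.
rewrite -(mulmxA A _ (W t)^T) fW WW eqxx (mulmxA (W t)) Wx mul0mx mulmx0.
by rewrite -(mulmxA A) (mulmxA f) fx mulmxA addr0 add0r.
Qed.

(** At [s = t] the Kalman gain equation says exactly this; for [s < t] the new
    measurement noise is orthogonal to the past. *)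
Lemma kferr_orth_of t s : (t < H)%N ->
  (forall r, (r < t)%N -> kerr t *m (ycoef r)^T = 0) ->
  (s <= t)%N -> kferr t *m (ycoef s)^T = 0.
Proof.
move=> tH ky; rewrite leq_eqVlt => /predU1P[->|st].
  have [_ VV _ _] := white tH tH.
  have [_ kV] := err_future kgain (leqnn t) tH.
  rewrite /ycoef linearD/= trmx_mul mulmxDr mulmxA.
  rewrite kferr_cross//; last by rewrite kerr_cross// ltnW.
  rewrite ferr_mulmx kV VV eqxx mulmx0 sub0r mul_mx_scalar.
  have g : riccati t *m C^T =
      kgain t *m C *m riccati t *m C^T + sigma_v ^+ 2 *: kgain t.
    rewrite -(gain_innovation C sigma_v_gt0); last exact: riccati_cov.
    by rewrite /innovation_cov mulmxDr mul_mx_scalar !mulmxA.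
  rewrite /filter_cov mulmxBl {1}g -/(kgain t) -addrA -opprD.
  exact: subrr.
have sH : (s < H)%N by exact: ltn_trans tH.
have [_ VV _ _] := white tH sH.
have [_ xV] := err_future (fun=> 0) (ltnW st) tH.
have Vy : V t *m (ycoef s)^T = 0.
  rewrite /ycoef linearD/= trmx_mul mulmxDr VV gtn_eqF// addr0 mulmxA.
  suff -> : V t *m (xcoef s)^T = 0 by rewrite mul0mx.
  exact: mulmx_tr_eq0 xV.
by rewrite ferr_mulmx ky// Vy !mulmx0 subr0.
Qed.

(** Orthogonality of the error to all past outputs characterizes the optimal
    linear estimator; the gain is chosen to make the filtered error orthogonal
    to the last output. *)
Lemma kerr_orth t s : (t <= H)%N -> (s < t)%N -> kerr t *m (ycoef s)^T = 0.
Proof.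
elim: t s => // t IH s tH st.
have sH : (s < H)%N by exact: leq_trans st tH.
have Wy : W t *m (ycoef s)^T = 0.
  have [_ _ _ WV] := white tH sH.
  have [xW _] := err_future (fun=> 0) (st : (s <= t)%N) tH.
  rewrite /ycoef linearD/= trmx_mul mulmxDr WV addr0 mulmxA.
  suff -> : W t *m (xcoef s)^T = 0 by rewrite mul0mx.
  exact: mulmx_tr_eq0 xW.
rewrite /= -/(kferr t) mulmxDl -mulmxA Wy addr0.
rewrite (_ : kferr t *m _ = 0) ?mulmx0//; apply: kferr_orth_of => // r rt.
by apply: IH => //; exact: ltnW.
Qed.

Lemma kferr_orth t s : (t < H)%N -> (s <= t)%N -> kferr t *m (ycoef s)^T = 0.
Proof.
by move=> tH; apply: kferr_orth_of => // r; apply: kerr_orth; exact: ltnW.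
Qed.

End error_coefficients.

(** * Sigma-algebras of random variables and the noise up to a horizon *)

Section sigma_algebra_of_variables.
Context d (T : measurableType d) (R : realType).
Implicit Types (F : set (T -> R)) (g : T -> R).

Definition variable_events F : set (set T) :=
  \bigcup_(f in F) preimage_set_system setT f measurable.

Lemma determined_byP F g : determined_by F g <->
  measurable_fun setT (g : g_sigma_algebraType (variable_events F) -> R).
Proof.
split=> [dg _ B mB|mg B mB]; first by rewrite setTI; exact: dg.
by have := mg measurableT B mB; rewrite setTI.
Qed.

Lemma determined_by_mem F g : F g -> determined_by F g.
Proof.
move=> Fg B mB; apply: sub_sigma_algebra; exists g => //.
by exists B => //; rewrite setTI.
Qed.

Lemma sigma_of_sub F (M : set (set T)) :
  (forall f B, F f -> measurable B -> <<s M >> (f @^-1` B)) ->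
  sigma_of F `<=` <<s M >>.
Proof.
move=> FM; apply: sigma_sub => _ [f Ff [B mB <-]]; rewrite setTI.
exact: FM.
Qed.

Lemma determined_by_measurable F g : (forall f, F f -> measurable_fun setT f) ->
  determined_by F g -> measurable_fun setT g.
Proof.
move=> mF dg _ B mB; rewrite setTI.
have : sigma_of F `<=` measurable.
  apply: smallest_sub; first exact: sigma_algebra_measurable.
  by move=> _ [f Ff [B' mB' <-]]; exact: mF.
by apply; exact: dg.
Qed.

End sigma_algebra_of_variables.

(** Lagrange's identity. *)
Lemma cauchy_schwarz_sum (R : realFieldType) (I : finType) (a b : I -> R) :
  (\sum_i a i * b i) ^+ 2 <= (\sum_i a i ^+ 2) * (\sum_i b i ^+ 2).
Proof.
have : 0 <= \sum_i \sum_j (a i * b j - a j * b i) ^+ 2.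
  by apply: sumr_ge0 => i _; apply: sumr_ge0 => j _; rewrite sqr_ge0.
have -> : \sum_i \sum_j (a i * b j - a j * b i) ^+ 2 =
    (\sum_i a i ^+ 2) * (\sum_i b i ^+ 2)
    + (\sum_i b i ^+ 2) * (\sum_i a i ^+ 2)
    - 2 * ((\sum_i a i * b i) * (\sum_i a i * b i)).
  rewrite !mulr_suml mulr_sumr -big_split -sumrB /=; apply: eq_bigr => i _.
  rewrite !mulr_sumr -big_split -sumrB /=; apply: eq_bigr => j _.
  by ring.
by rewrite -expr2; lra.
Qed.

Section finite_horizon.
Context {R : realType} (n m H : nat).
Variables (sigma_w sigma_v : R).

(** The scalar noises that occur before the horizon [H]; only finitely many are
    needed at a given time, which makes matrices of coefficients available. *)
Definition noise_index : Type := ('I_H * 'I_n + 'I_H * 'I_m)%type.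
Definition noise_dim := #|{: noise_index}|.
Notation N := noise_dim.

Definition noise_tag (k : 'I_N) : (nat * 'I_n) + (nat * 'I_m) :=
  match enum_val k with
  | inl (t, a) => inl (nat_of_ord t, a)
  | inr (t, j) => inr (nat_of_ord t, j)
  end.

Lemma noise_tag_inj : injective noise_tag.
Proof.
move=> k l; rewrite /noise_tag => kl; apply: enum_val_inj; move: kl.
case: (enum_val k) => [[t a]|[t a]]; case: (enum_val l) => [[s b]|[s b]] //.
  by case=> /val_inj -> ->.
by case=> /val_inj -> ->.
Qed.

Lemma noise_tag_surj x : ((match x with inl (t, _) => t | inr (t, _) => t end) < H)%N ->
  exists k, noise_tag k = x.
Proof.
case: x => [[t a]|[t a]] tH.
  exists (enum_rank (inl (Ordinal tH, a) : noise_index)).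
  by rewrite /noise_tag enum_rankK.
exists (enum_rank (inr (Ordinal tH, a) : noise_index)).
by rewrite /noise_tag enum_rankK.
Qed.

Definition wcoef (t : nat) : 'M[R]_(n, N) :=
  \matrix_(a, k) (sigma_w * (noise_tag k == inl (t, a))%:R).
Definition vcoef (t : nat) : 'M[R]_(m, N) :=
  \matrix_(j, k) (sigma_v * (noise_tag k == inr (t, j))%:R).

Lemma sum_tag x (F : 'I_N -> R) k : noise_tag k = x ->
  \sum_l (noise_tag l == x)%:R * F l = F k.
Proof.
move=> kx; rewrite (bigD1 k)//= kx eqxx mul1r big1 ?addr0// => l lk.
by rewrite -kx (inj_eq noise_tag_inj) (negPf lk) mul0r.
Qed.

Lemma white_coefs : white_coefficients H sigma_w sigma_v wcoef vcoef.
Proof.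
move=> s t sH tH.
have gen (x y : (nat * 'I_n) + (nat * 'I_m)) (p q : R) :
    (exists k, noise_tag k = x) ->
    \sum_l (p * (noise_tag l == x)%:R) * (q * (noise_tag l == y)%:R)
    = p * q * (x == y)%:R.
  case=> k kx; under eq_bigr do rewrite mulrACA mulrC -mulrA.
  by rewrite (sum_tag _ kx) kx mulrC.
split.
- apply/matrixP => a b; rewrite !mxE.
  under eq_bigr do rewrite !mxE.
  rewrite gen; last exact: noise_tag_surj.
  rewrite /eq_op /= /eq_op /= -/(eq_op _ _) -expr2.
  by case: eqVneq => [_|_] /=; rewrite !mxE ?mulr0// mulr_natr.
- apply/matrixP => a b; rewrite !mxE.
  under eq_bigr do rewrite !mxE.
  rewrite gen; last exact: noise_tag_surj.
  rewrite /eq_op /= /eq_op /= -/(eq_op _ _) -expr2.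
  by case: eqVneq => [_|_] /=; rewrite !mxE ?mulr0// mulr_natr.
- apply/matrixP => a b; rewrite !mxE.
  under eq_bigr do rewrite !mxE.
  by rewrite gen ?mulr0//; exact: noise_tag_surj.
- apply/matrixP => a b; rewrite !mxE.
  under eq_bigr do rewrite !mxE.
  by rewrite gen ?mulr0//; exact: noise_tag_surj.
Qed.

End finite_horizon.

(** * The model restricted to the good sensors *)

Section good_sensors.
Context (R : realType) (d : measure_display) (T : measurableType d)
  (P : probability T R) (n p : nat) (A : 'M[R]_n) (C : 'M[R]_(p, n))
  (sigma_w sigma_v : R) (x0 : 'I_n -> {RV P >-> R})
  (w : nat -> 'I_n -> {RV P >-> R}) (v : nat -> 'I_p -> {RV P >-> R})
  (kappa : {set 'I_p}).
Hypotheses (sigma_w_gt0 : 0 < sigma_w) (sigma_v_gt0 : 0 < sigma_v).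
Hypothesis noise : gaussian_noise_model sigma_w sigma_v x0 w v.

Notation m := #|~: kappa|.
Notation Cg := (sensor_rows C (~: kappa)).
Notation x := (state A x0 w).

Definition good_sensor (j : 'I_m) : 'I_p := enum_val j.

Definition good_noise (t : nat) (omega : T) : 'cV[R]_m :=
  \col_j v t (good_sensor j) omega.

Definition good_output (t : nat) (omega : T) : 'cV[R]_m :=
  Cg *m x t omega + good_noise t omega.

Lemma good_outputE t omega j : good_output t omega j 0 =
  (C *m x t omega) (good_sensor j) 0 + v t (good_sensor j) omega.
Proof.
rewrite !mxE; congr (_ + _); apply: eq_bigr => i _.
by rewrite /sensor_rows mxE.
Qed.

Definition initial_variables : set (T -> R) :=
  [set f | exists a, f = (x0 a : T -> R)].
Notation G := (sigma_of initial_variables).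

Lemma measurable_initial : G `<=` measurable.
Proof.
apply: smallest_sub; first exact: sigma_algebra_measurable.
move=> _ [_ [a ->] [B mB <-]]; exact: measurable_funPT.
Qed.

Lemma initial_setI : setI_closed G.
Proof.
exact: (@measurableI _ (g_sigma_algebraType (variable_events initial_variables))).
Qed.

Lemma initial_setT : G setT.
Proof.
exact: (@measurableT _ (g_sigma_algebraType (variable_events initial_variables))).
Qed.

Section horizon.
Variable H : nat.
Notation N := (noise_dim n m H).

Definition normalized_noise (k : (nat * 'I_n) + (nat * 'I_m)) (omega : T) : R :=
  match k with
  | inl (t, a) => w t a omega / sigma_w
  | inr (t, j) => v t (good_sensor j) omega / sigma_v
  end.

Definition noise_coord (k : 'I_N) : T -> R := normalized_noise (noise_tag k).
Definition noise_vec (omega : T) : 'cV[R]_N := \col_k noise_coord k omega.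

Notation W := (@wcoef R n m H sigma_w).
Notation V := (@vcoef R n m H sigma_v).

Lemma wcoefE t omega : (t < H)%N -> W t *m noise_vec omega = vec (w t) omega.
Proof.
move=> tH; apply/colP => a; rewrite !mxE.
have [k kt] := @noise_tag_surj n m H (inl (t, a)) tH.
under eq_bigr do rewrite !mxE -mulrA.
rewrite -mulr_sumr (sum_tag _ kt) /noise_coord kt /=.
by rewrite mulrC divfK// gt_eqF.
Qed.

Lemma vcoefE t omega : (t < H)%N -> V t *m noise_vec omega = good_noise t omega.
Proof.
move=> tH; apply/colP => a; rewrite !mxE.
have [k kt] := @noise_tag_surj n m H (inr (t, a)) tH.
under eq_bigr do rewrite !mxE -mulrA.
rewrite -mulr_sumr (sum_tag _ kt) /noise_coord kt /=.
by rewrite mulrC divfK// gt_eqF.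
Qed.

Definition block_of_tag (k : (nat * 'I_n) + (nat * 'I_m)) :
    option ((nat * 'I_n) + (nat * 'I_p)) :=
  match k with
  | inl q => Some (inl q)
  | inr (t, j) => Some (inr (t, good_sensor j))
  end.

Lemma block_of_tag_inj : injective block_of_tag.
Proof.
move=> [[t a]|[t a]] [[s b]|[s b]] //=; first by case=> -> ->.
by case=> -> /enum_val_inj ->.
Qed.

Lemma measurable_normalized_noise k : measurable_fun setT (normalized_noise k).
Proof. by case: k => [[t a]|[t a]]; apply: measurable_funM. Qed.

Lemma normalized_noise_law k (B : set R) : measurable B ->
  P (normalized_noise k @^-1` B) = normal_prob 0 1 B.
Proof.
have [wlaw vlaw _ _] := noise => mB.
have pre (s : R) : measurable ((fun y : R => y / s) @^-1` B).
  by apply: measurable_preimageR => //; exact: measurable_funM.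
case: k => [[t a]|[t j]].
  by rewrite -(normal_scale sigma_w_gt0 mB) -(wlaw t a _ (pre sigma_w)).
by rewrite -(normal_scale sigma_v_gt0 mB) -(vlaw t (good_sensor j) _ (pre sigma_v)).
Qed.

Lemma normalized_noise_block k (B : set R) : measurable B ->
  sigma_of (noise_blocks x0 w v (block_of_tag k)) (normalized_noise k @^-1` B).
Proof.
move=> mB; have pre (s : R) : measurable ((fun y : R => y / s) @^-1` B).
  by apply: measurable_preimageR => //; exact: measurable_funM.
case: k => [[t a]|[t j]].
  by apply: (determined_by_mem (g := w t a) _ (pre sigma_w)).
by apply: (determined_by_mem (g := v t (good_sensor j)) _ (pre sigma_v)).
Qed.

(** The mutual independence of all blocks is used for the block of the initial
    state and the noises before the horizon.  Since it is indexed by blocks,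
    the events given on coordinates are transported along the injection
    [iota]. *)
Lemma noise_standard_given : standard_given P G noise_coord.
Proof.
split=> [k|D B GD mB]; first exact: measurable_normalized_noise.
have [_ _ _ indep] := noise.
pose iota k := block_of_tag (@noise_tag n m H k).
have iota_inj : injective iota.
  by move=> k l /block_of_tag_inj /noise_tag_inj.
pose E i := match i with
  | None => D
  | _ => if [pick k | iota k == i] is Some k then noise_coord k @^-1` B k else setT
  end.
have iotaS k : exists y, iota k = Some y.
  rewrite /iota; case: (noise_tag k) => [q|[t j]]; first by exists (inl q).
  by exists (inr (t, good_sensor j)).
have Ei k : E (iota k) = noise_coord k @^-1` B k.
  rewrite /E; have [y yE] := iotaS k; rewrite yE -yE.
  case: pickP => [l /eqP /iota_inj -> //|/(_ k)]; by rewrite eqxx.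
have us : uniq (None :: [seq iota k | k <- index_enum 'I_N]).
  rewrite /= map_inj_uniq// index_enum_uniq andbT; apply/mapP => -[k _].
  by have [y ->] := iotaS k.
have := indep _ E us; rewrite !big_cons !big_map /=.
rewrite (eq_bigr (fun k => noise_coord k @^-1` B k)); last by move=> k _; exact: Ei.
move=> ->; last first.
  move=> i; rewrite inE => /predU1P[->//|/mapP[k _ ->]].
  by rewrite Ei; exact: normalized_noise_block.
congr (_ * _)%E; apply: eq_bigr => k _.
by rewrite Ei normalized_noise_law.
Qed.

Implicit Type L : nat -> 'M[R]_(n, m).

Notation err_coef := (@err_coef R n m N A Cg W V).
Notation ferr_coef := (@ferr_coef R n m N A Cg W V).
Notation xcoef := (@xcoef R n m N A Cg W V).
Notation ycoef := (@ycoef R n m N A Cg W V).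

(** Coefficient of the prediction error on the initial state. *)
Fixpoint free_coef L (t : nat) : 'M[R]_n :=
  if t is t'.+1 then A *m ((1%:M - L t' *m Cg) *m free_coef L t') else 1%:M.

Fixpoint estimate L (t : nat) (omega : T) : 'cV[R]_n :=
  if t is t'.+1
  then A *m (estimate L t' omega +
             L t' *m (good_output t' omega - Cg *m estimate L t' omega))
  else 0.

Definition filtered_estimate L (t : nat) (omega : T) : 'cV[R]_n :=
  estimate L t omega + L t *m (good_output t omega - Cg *m estimate L t omega).

(** Stated as a step from the prediction error, because the recursion for the
    prediction error itself goes through the filtered one. *)
Lemma filtered_error_of L t omega : (t < H)%N ->
  x t omega - estimate L t omega =
    free_coef L t *m vec x0 omega + err_coef L t *m noise_vec omega ->
  x t omega - filtered_estimate L t omega =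
    (1%:M - L t *m Cg) *m free_coef L t *m vec x0 omega + ferr_coef L t *m noise_vec omega.
Proof.
move=> tH e; have -> : x t omega - filtered_estimate L t omega =
    (1%:M - L t *m Cg) *m (x t omega - estimate L t omega)
    - L t *m good_noise t omega.
  rewrite /filtered_estimate /good_output (addrAC _ (good_noise t omega)) -mulmxBr.
  by rewrite mulmxDr mulmxBl mul1mx !opprD !addrA mulmxA.
by rewrite e mulmxDr -vcoefE// ferr_mulmx !mulmxA addrA.
Qed.

Lemma prediction_error L t omega : (t <= H)%N ->
  x t omega - estimate L t omega =
  free_coef L t *m vec x0 omega + err_coef L t *m noise_vec omega.
Proof.
elim: t => [|t IH] tH; first by rewrite /= subr0 mul1mx mul0mx addr0.
have := filtered_error_of tH (IH (ltnW tH)).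
rewrite /= -/(filtered_estimate L t omega) -/(ferr_coef L t) => e.
rewrite addrAC -mulmxBr e [(_ + W t) *m _]mulmxDl wcoefE// mulmxDr.
by rewrite !mulmxA addrA.
Qed.

Lemma filtering_error L t omega : (t < H)%N ->
  x t omega - filtered_estimate L t omega =
  (1%:M - L t *m Cg) *m free_coef L t *m vec x0 omega + ferr_coef L t *m noise_vec omega.
Proof. by move=> tH; apply: filtered_error_of => //; rewrite prediction_error// ltnW. Qed.

Lemma state_coef t omega : (t <= H)%N ->
  x t omega = free_coef (fun=> 0) t *m vec x0 omega + xcoef t *m noise_vec omega.
Proof.
move=> /(prediction_error (fun=> 0) omega) <-.
rewrite [estimate _ _ _](_ : _ = 0) ?subr0//.
by elim: t => //= t ->; rewrite mul0mx addr0 mulmx0.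
Qed.

Lemma good_output_coef t omega : (t < H)%N ->
  good_output t omega =
  Cg *m free_coef (fun=> 0) t *m vec x0 omega + ycoef t *m noise_vec omega.
Proof.
move=> tH; have -> : ycoef t = Cg *m xcoef t + V t by [].
rewrite /good_output (state_coef omega (ltnW tH)) mulmxDr mulmxDl (vcoefE omega tH).
by rewrite !mulmxA addrA.
Qed.

Definition good_outputs_before (r : nat) : set (T -> R) :=
  [set f | exists s j, (s < r)%N /\ f = (fun omega => good_output s omega j 0)].

Section orthogonal_error.
Variable a : 'I_N -> R.
Notation M := (orthogonal_events G noise_coord a).

Lemma measurable_lincomb k (B : 'M[R]_(k, n)) j :
  measurable_fun setT
    ((fun omega => (B *m vec x0 omega) j 0) : g_sigma_algebraType M -> R).
Proof.
under eq_fun do rewrite mxE.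
apply: measurable_sum => i; under eq_fun do rewrite mxE.
apply: measurable_funM => // _ B' mB'; rewrite setTI.
apply: sub_sigma_algebra; left; apply: determined_by_mem => //.
by exists i.
Qed.

Lemma measurable_noise_comb k (B : 'M[R]_(k, N)) j :
  dot (fun l => B j l) a = 0 ->
  measurable_fun setT
    ((fun omega => (B *m noise_vec omega) j 0) : g_sigma_algebraType M -> R).
Proof.
move=> Ba _ B' mB'; rewrite setTI; apply: sub_sigma_algebra; right.
exists (fun l => B j l); split => //; exists B' => //.
have e omega : (B *m noise_vec omega) j 0 = dot (fun l => B j l) (noise_coord^~ omega).
  by rewrite mxE; apply: eq_bigr => l _; rewrite mxE.
by apply/seteqP; split=> omega /=; rewrite e.
Qed.

End orthogonal_error.

(** [E] is a candidate error: the state minus [E Z] and all the observations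
    depend only on the initial state and on combinations of the noise
    orthogonal to row [i] of [E], hence so does [h] in the decomposition
    [x_i - g = (E Z)_i + h]. *)
Lemma mse_lower_bound (E : 'M[R]_(n, N)) t r (g : T -> R) i :
  (t <= H)%N -> (r <= H)%N -> E *m E^T = E *m (xcoef t)^T ->
  (forall s, (s < r)%N -> E *m (ycoef s)^T = 0) ->
  determined_by (good_outputs_before r) g ->
  (((E *m E^T) i i)%:E <= \int[P]_omega ((x t omega i 0 - g omega) ^+ 2)%:E)%E.
Proof.
move=> tH rH EE EY dg.
pose a := fun k => E i k.
have orth k (B : 'M[R]_(k, N)) j : E *m B^T = 0 -> dot (fun l => B j l) a = 0.
  move=> /matrixP/(_ i j); rewrite !mxE => <-.
  by rewrite /dot; apply: eq_bigr => l _; rewrite mxE mulrC.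
pose h omega := (free_coef (fun=> 0) t *m vec x0 omega) i 0
  + ((xcoef t - E) *m noise_vec omega) i 0 - g omega.
have xE omega : x t omega i 0 - g omega = dot a (noise_coord^~ omega) + h omega.
  rewrite /h state_coef// mulmxBl !mxE addrA; congr (_ - _).
  rewrite [in RHS]addrCA; congr (_ + _).
  have -> : dot a (noise_coord^~ omega) = \sum_j E i j * noise_vec omega j 0.
    by apply: eq_bigr => l _; rewrite mxE.
  by rewrite addrC subrK.
under eq_integral do rewrite xE.
rewrite (orthogonal_noise_second_moment measurable_initial initial_setI
  initial_setT (noise_standard_given)).
  rewrite [(E *m E^T) i i](_ : _ = dot a a); last first.
    by rewrite mxE; apply: eq_bigr => k _; rewrite mxE.
  by rewrite leeDl// integral_ge0// => omega _; rewrite lee_fin sqr_ge0.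
move=> B mB.
suff mh : measurable_fun setT
    (h : g_sigma_algebraType (orthogonal_events G noise_coord a) -> R).
  by have := mh measurableT B mB; rewrite setTI.
apply: measurable_funB; first apply: measurable_funD.
- exact: measurable_lincomb.
- by apply: measurable_noise_comb; apply: orth; rewrite linearB/= mulmxBr EE subrr.
move=> _ B' mB'; rewrite setTI.
apply: (sigma_of_sub _ (dg _ mB')) => _ {}B' [s [j [sr ->]]] {}mB'.
suff my : measurable_fun setT ((fun omega => good_output s omega j 0)
    : g_sigma_algebraType (orthogonal_events G noise_coord a) -> R).
  by have := my measurableT B' mB'; rewrite setTI.
have sH : (s < H)%N by exact: leq_trans rH.
under eq_fun do rewrite good_output_coef// mxE.
apply: measurable_funD; first exact: measurable_lincomb.
by apply: measurable_noise_comb; apply: orth; exact: EY.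
Qed.

Definition initial_energy : R := fine (\int[P]_omega (\sum_a x0 a omega ^+ 2)%:E).

Lemma initial_energyE :
  (\int[P]_omega (\sum_a x0 a omega ^+ 2)%:E)%E = initial_energy%:E.
Proof.
rewrite /initial_energy fineK//; under eq_integral do rewrite -sumEFin.
rewrite ge0_integral_sum//; last 2 first.
- by move=> a; apply/measurable_EFinP; exact: measurable_funX.
- by move=> a omega _; rewrite lee_fin sqr_ge0.
apply/sum_fin_numP => a _ _; apply: integrable_fin_num => //.
by have [_ _ /(_ a) + _] := noise; exact: Lfun2_integrable_sqr.
Qed.

Lemma initial_energy_ge0 : 0 <= initial_energy.
Proof.
rewrite -lee_fin -initial_energyE; apply: integral_ge0 => omega _.
by rewrite lee_fin sumr_ge0// => a _; rewrite sqr_ge0.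
Qed.

(** The cross term vanishes because the noise is symmetric given the initial
    state; the part of the initial state is bounded by the Cauchy-Schwarz
    inequality. *)
Lemma error_energy_le (F : 'M[R]_n) (D : 'M[R]_(n, N)) i :
  (\int[P]_omega (((F *m vec x0 omega + D *m noise_vec omega) i 0) ^+ 2)%:E
   <= ((D *m D^T + initial_energy *: (F *m F^T)) i i)%:E)%E.
Proof.
pose a := fun k => D i k.
pose h omega := (F *m vec x0 omega) i 0.
have mh : measurable_fun setT
    (h : g_sigma_algebraType (orthogonal_events G noise_coord a) -> R).
  exact: measurable_lincomb.
have mx0 b : measurable_fun setT (x0 b : T -> R) by [].
have mh' : measurable_fun setT h.
  rewrite /h; under eq_fun do rewrite mxE.
  apply: measurable_sum => j; under eq_fun do rewrite mxE.
  exact: measurable_funM.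
have -> : (\int[P]_omega (((F *m vec x0 omega + D *m noise_vec omega) i 0) ^+ 2)%:E
    = \int[P]_omega ((dot a (noise_coord^~ omega) + h omega) ^+ 2)%:E)%E.
  apply: eq_integral => omega _; congr (_ ^+ 2)%:E; rewrite mxE addrC; congr (_ + _).
  by rewrite mxE; apply: eq_bigr => l _; rewrite mxE.
rewrite (orthogonal_noise_second_moment measurable_initial initial_setI
  initial_setT noise_standard_given); last first.
  by move=> B mB; have := mh measurableT B mB; rewrite setTI.
rewrite mxE EFinD; apply: leeD.
  by rewrite lee_fin mxE /dot; apply: ler_sum => l _; rewrite mxE.
rewrite [X in (_ <= X)%E](_ : _ = ((F *m F^T) i i)%:E * initial_energy%:E)%E; last first.
  by rewrite mxE -EFinM mulrC.
rewrite -initial_energyE -ge0_integralZl_EFin//; last 3 first.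
- by move=> omega _; rewrite lee_fin sumr_ge0// => b _; rewrite sqr_ge0.
- apply/measurable_EFinP; apply: measurable_sum => b; exact: measurable_funX.
- by rewrite mxE sumr_ge0// => l _; rewrite mxE -expr2 sqr_ge0.
apply: ge0_le_integral => //.
- by move=> omega _; rewrite lee_fin sqr_ge0.
- by apply/measurable_EFinP; exact: measurable_funX.
- apply: measurable_funeM; apply/measurable_EFinP.
  by apply: measurable_sum => b; exact: measurable_funX.
move=> omega _; rewrite -EFinM lee_fin /h [X in X ^+ 2]mxE.
apply: le_trans (cauchy_schwarz_sum _ _) _.
rewrite [leLHS](_ : _ = (F *m F^T) i i * \sum_b x0 b omega ^+ 2)//.
congr (_ * _); first by rewrite mxE; apply: eq_bigr => l _; rewrite mxE expr2.
by apply: eq_bigr => l _; rewrite mxE.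
Qed.

Section steady_gain.
Variables (Ps : 'M[R]_n) (c : R).
Notation K := (kalman_gain Cg sigma_v Ps).
Notation L := (fun=> K).
Notation Sigma := (steady_gain_cov A Cg sigma_w sigma_v Ps c).

(** The covariance updates are affine, so they act on the noise part and on the
    initial part side by side. *)
Lemma steady_gain_fgram_of t : (t < H)%N ->
  err_coef L t *m (err_coef L t)^T + c *: (free_coef L t *m (free_coef L t)^T) = Sigma t ->
  ferr_coef L t *m (ferr_coef L t)^T +
    c *: ((1%:M - K *m Cg) *m free_coef L t *m ((1%:M - K *m Cg) *m free_coef L t)^T) =
  measurement_update Cg sigma_v K (Sigma t).
Proof.
move=> tH <-; rewrite (ferr_gram _ _ (@white_coefs R n m H sigma_w sigma_v))//.
rewrite /measurement_update; move: (1%:M - K *m Cg) => B.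
rewrite mulmxDr mulmxDl -scalemxAr -scalemxAl (trmx_mul B) !mulmxA.
by rewrite addrAC.
Qed.

Lemma steady_gain_gram t : (t <= H)%N ->
  err_coef L t *m (err_coef L t)^T + c *: (free_coef L t *m (free_coef L t)^T) = Sigma t.
Proof.
elim: t => [|t IH] tH.
  by rewrite /= mul0mx add0r trmx1 mulmx1 scalemx1.
rewrite (err_gram _ _ (@white_coefs R n m H sigma_w sigma_v))//.
rewrite [Sigma t.+1]/= -(steady_gain_fgram_of tH (IH (ltnW tH))).
rewrite /time_update [free_coef L t.+1]/=.
move: ((1%:M - K *m Cg) *m free_coef L t) (ferr_coef L t *m _) => B D.
by rewrite mulmxDr mulmxDl -scalemxAr -scalemxAl (trmx_mul A) !mulmxA addrAC.
Qed.

Lemma steady_gain_fgram t : (t < H)%N ->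
  ferr_coef L t *m (ferr_coef L t)^T +
    c *: ((1%:M - K *m Cg) *m free_coef L t *m ((1%:M - K *m Cg) *m free_coef L t)^T) =
  measurement_update Cg sigma_v K (Sigma t).
Proof.
by move=> tH; apply: steady_gain_fgram_of => //; exact/steady_gain_gram/ltnW.
Qed.

End steady_gain.

End horizon.
End good_sensors.

(** * The attack *)

Section jamming_attack.
Context (R : realType) (d : measure_display) (T : measurableType d)
  (P : probability T R) (n p : nat) (A : 'M[R]_n) (C : 'M[R]_(p, n))
  (x0 : 'I_n -> {RV P >-> R})
  (w : nat -> 'I_n -> {RV P >-> R}) (v : nat -> 'I_p -> {RV P >-> R})
  (kappa : {set 'I_p}).

Notation m := #|~: kappa|.
Notation Cg := (sensor_rows C (~: kappa)).
Notation x := (state A x0 w).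
Notation yg := (@good_output R d T P n p A C x0 w v kappa).
Notation before := (@good_outputs_before R d T P n p A C x0 w v kappa).
Notation est := (@estimate R d T P n p A C x0 w v kappa).
Notation fest := (@filtered_estimate R d T P n p A C x0 w v kappa).

Lemma measurable_state t i : measurable_fun setT (fun omega => x t omega i 0).
Proof.
elim: t i => [|t IH] i /=.
  by under eq_fun do rewrite mxE; exact: measurable_funPT.
under eq_fun do rewrite !mxE; apply: measurable_funD; last exact: measurable_funPT.
by apply: measurable_sum => j; apply: measurable_funM.
Qed.

Definition true_output (t : nat) (j : 'I_p) (omega : T) : R :=
  (C *m x t omega) j 0 + v t j omega.

Lemma measurable_true_output t j : measurable_fun setT (true_output t j).
Proof.
apply: measurable_funD => //; under eq_fun do rewrite mxE.
by apply: measurable_sum => i; apply: measurable_funM => //; exact: measurable_state.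
Qed.

Definition jam_fun (t : nat) (j : 'I_p) (omega : T) : R :=
  if j \in kappa then - true_output t j omega else 0.

Lemma measurable_jam t j : measurable_fun setT (jam_fun t j).
Proof.
rewrite /jam_fun; case: (j \in kappa); last exact: measurable_cst.
by apply: measurableT_comp => //; exact: measurable_true_output.
Qed.

Definition jam (t : nat) (j : 'I_p) : {RV P >-> R} :=
  HB.pack (jam_fun t j) (isMeasurableFun.Build _ _ _ _ _ (measurable_jam t j)).

Notation y := (output A C x0 w v jam).

Lemma output_jam t omega j :
  y t omega j 0 = if j \in kappa then 0 else true_output t j omega.
Proof.
rewrite /output /vec !mxE /= /jam_fun /true_output mxE.
by case: ifP => _; rewrite ?subrr ?addr0.
Qed.

Lemma k_adversary_jam k : #|kappa| = k -> k_adversary k A C x0 w v kappa jam.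
Proof.
move=> kk; split => // [t j omega jk|t j jk].
  by rewrite /= /jam_fun (negPf jk).
apply/determined_byP; rewrite /= /jam_fun jk; apply: measurableT_comp => //.
apply/determined_byP; apply: determined_by_mem.
by exists t; split => //; constructor 1; exists j.
Qed.

(** The outputs of the attacked sensors are constant, hence carry no
    information. *)
Lemma outputs_before_good r (g : T -> R) :
  determined_by (outputs_before y r) g ->
  determined_by (before r) g.
Proof.
move=> dg B mB; apply: (sigma_of_sub _ (dg _ mB)) => _ {}B [s [j [sr ->]]] {}mB.
have [jk|jk] := boolP (j \in kappa).
  suff : determined_by (before r)
      (fun omega => y s omega j 0) by apply.
  apply/determined_byP; under eq_fun do rewrite output_jam jk.
  exact: measurable_cst.
have jg : j \in ~: kappa by rewrite inE.
suff : determined_by (before r)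
    (fun omega => y s omega j 0) by apply.
apply: determined_by_mem; exists s, (enum_rank_in jg j); split => //.
apply/funext => omega; rewrite good_outputE /good_sensor enum_rankK_in//.
by rewrite output_jam (negPf jk).
Qed.

Lemma determined_by_good_output s r (j : 'I_m) : (s < r)%N ->
  determined_by (outputs_before y r) (fun omega => yg s omega j 0).
Proof.
move=> sr; apply: determined_by_mem; exists s, (good_sensor j); split => //.
apply/funext => omega; rewrite good_outputE output_jam.
have := enum_valP j; rewrite inE => /negPf jk.
by rewrite /good_sensor jk.
Qed.

Lemma determined_by_mulmx (F : set (T -> R)) a b (B : 'M[R]_(a, b))
    (X : T -> 'cV[R]_b) :
  (forall i, determined_by F (fun omega => X omega i 0)) ->
  forall i, determined_by F (fun omega => (B *m X omega) i 0).
Proof.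
move=> dX i; apply/determined_byP; under eq_fun do rewrite mxE.
apply: measurable_sum => j; apply: measurable_funM => //.
exact/determined_byP.
Qed.

Lemma determined_byD (F : set (T -> R)) a (X Y : T -> 'cV[R]_a) :
  (forall i, determined_by F (fun omega => X omega i 0)) ->
  (forall i, determined_by F (fun omega => Y omega i 0)) ->
  forall i, determined_by F (fun omega => (X omega + Y omega) i 0).
Proof.
move=> dX dY i; apply/determined_byP; under eq_fun do rewrite mxE.
by apply: measurable_funD; apply/determined_byP.
Qed.

Lemma determined_by_correction (F : set (T -> R)) (L : 'M[R]_(n, m))
    (X : T -> 'cV[R]_n) s :
  (forall i, determined_by F (fun omega => X omega i 0)) ->
  (forall j : 'I_m,
    determined_by F (fun omega => yg s omega j 0)) ->
  forall i, determined_by F (fun omega =>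
    (X omega + L *m (yg s omega - Cg *m X omega)) i 0).
Proof.
move=> dX dy; apply: determined_byD => //; apply: determined_by_mulmx => i.
have -> : (fun omega => (yg s omega - Cg *m X omega) i 0) =
  (fun omega => (yg s omega + (- Cg) *m X omega) i 0).
  by apply/funext => omega; rewrite mulNmx.
by apply: determined_byD => //; apply: determined_by_mulmx.
Qed.

Lemma determined_by_estimate L t r : (t <= r)%N ->
  forall i, determined_by (outputs_before y r)
    (fun omega => est L t omega i 0).
Proof.
elim: t => [|t IH] tr /=.
  move=> i; apply/determined_byP; under eq_fun do rewrite mxE.
  exact: measurable_cst.
apply: determined_by_mulmx; apply: determined_by_correction.
  by move=> i; apply: IH; exact: ltnW.
by move=> j; exact: determined_by_good_output.
Qed.

Lemma determined_by_filtered_estimate L t r : (t < r)%N ->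
  forall i, determined_by (outputs_before y r)
    (fun omega => fest L t omega i 0).
Proof.
move=> tr; apply: determined_by_correction.
  by apply: determined_by_estimate; exact: ltnW.
by move=> j; exact: determined_by_good_output.
Qed.

Lemma measurable_outputs_before r f : outputs_before y r f -> measurable_fun setT f.
Proof.
move=> [s [j [_ ->]]]; under eq_fun do rewrite output_jam.
by case: (j \in kappa); [exact: measurable_cst|exact: measurable_true_output].
Qed.

Lemma mse_sum (X Y : T -> 'cV[R]_n) :
  (forall i, measurable_fun setT (fun omega => X omega i 0)) ->
  (forall i, measurable_fun setT (fun omega => Y omega i 0)) ->
  mse P X Y = (\sum_i \int[P]_omega ((X omega i 0 - Y omega i 0) ^+ 2)%:E)%E.
Proof.
move=> mX mY; rewrite /mse unlock.
rewrite -ge0_integral_sum//.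
- apply: eq_integral => omega _; rewrite sumEFin; congr EFin.
  by apply: eq_bigr => i _; rewrite !mxE.
- by move=> i; apply/measurable_EFinP/measurable_funX/measurable_funB.
- by move=> i omega _; rewrite lee_fin sqr_ge0.
Qed.

Lemma tr_error_cov (X Y : T -> 'cV[R]_n) :
  \tr (error_cov P (fun omega => X omega - Y omega)) =
  (\sum_i \int[P]_omega ((X omega i 0 - Y omega i 0) ^+ 2)%:E)%E.
Proof.
apply: eq_bigr => i _; rewrite mxE unlock; apply: eq_integral => omega _.
by rewrite !mxE expr2.
Qed.

End jamming_attack.

Lemma tr_quad (R : realFieldType) n (S : 'M[R]_n) :
  \tr S = \sum_i quad S (delta_mx 0 i).
Proof. by apply: eq_bigr => i _; rewrite quad_delta. Qed.

Lemma steady_error_sandwich (R : realType) (d : measure_display)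
    (T : measurableType d) (P : probability T R) (n : nat)
    (X Y : nat -> T -> 'cV[R]_n) (rho c s : R) :
  0 <= rho < 1 ->
  (forall t, (((1 - rho ^+ t) * s)%:E <=
    \tr (error_cov P (fun omega => (X t omega - Y t omega)%R)) <=
    ((1 + c * rho ^+ t) * s)%:E)%E) ->
  steady_error P (fun t omega => X t omega - Y t omega) s.
Proof.
move=> /andP[r0 r1] b; rewrite /steady_error.
have rc : rho ^+ t @[t --> \oo] --> (0 : R) by apply: cvg_expr; rewrite ger0_norm.
apply: (@squeeze_cvge _ _ _ _ (fun t => ((1 - rho ^+ t) * s)%:E) _
  (fun t => ((1 + c * rho ^+ t) * s)%:E)).
- by apply: nearW => t; exact: b.
- apply: cvg_EFin; first by apply: nearW.
  have : (1 - rho ^+ t) * s @[t --> \oo] --> (1 - 0) * s.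
    by apply: cvgM; [apply: cvgB => //; exact: cvg_cst|exact: cvg_cst].
  by rewrite subr0 mul1r.
- apply: cvg_EFin; first by apply: nearW.
  have : (1 + c * rho ^+ t) * s @[t --> \oo] --> (1 + c * 0) * s.
    apply: cvgM; last exact: cvg_cst.
    by apply: cvgD; [exact: cvg_cst|apply: cvgM => //; exact: cvg_cst].
  by rewrite mulr0 addr0 mul1r.
Qed.

(** * Convergence of the oracle error *)

(** A minimum error lies between a lower bound [lo] valid for every estimator
    and the error bound [up] of some estimator, so the limit follows when both
    approach [S] geometrically. *)
Lemma mmse_steady_error (R : realType) (d : measure_display)
    (T : measurableType d) (P : probability T R) (n : nat)
    (F : nat -> set (T -> R)) (X Y : nat -> T -> 'cV[R]_n)
    (lo up : nat -> 'M[R]_n) (S : 'M[R]_n) (rho c : R) :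
  0 <= rho < 1 ->
  (forall t f, F t f -> measurable_fun setT f) ->
  (forall t i, measurable_fun setT (fun omega => X t omega i 0)) ->
  (forall t, mmse_estimator P (F t) (X t) (Y t)) ->
  (forall t g i, determined_by (F t) g ->
    ((lo t i i)%:E <= \int[P]_omega ((X t omega i 0 - g omega) ^+ 2)%:E)%E) ->
  (forall t u, (1 - rho ^+ t) * quad S u <= quad (lo t) u) ->
  (forall t, exists2 Z : T -> 'cV[R]_n,
    forall i, determined_by (F t) (fun omega => Z omega i 0) &
    forall i, (\int[P]_omega ((X t omega i 0 - Z omega i 0) ^+ 2)%:E
      <= (up t i i)%:E)%E) ->
  (forall t u, quad (up t) u <= (1 + c * rho ^+ t) * quad S u) ->
  steady_error P (fun t omega => X t omega - Y t omega) (\tr S).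
Proof.
move=> rho01 mF mX mmse lower lo_S upper up_S.
have mdet t g : determined_by (F t) g -> measurable_fun setT g.
  by apply: determined_by_measurable => f; exact: mF.
apply: (steady_error_sandwich (c := c) rho01) => t.
have [dY optY] := mmse t; rewrite tr_error_cov; apply/andP; split.
  rewrite tr_quad mulr_sumr.
  apply: (@le_trans _ _ (\sum_i (lo t i i)%:E)%E); last first.
    by apply: lee_sum => i _; exact: lower.
  by rewrite sumEFin lee_fin; apply: ler_sum => i _; rewrite -[leRHS]quad_delta.
rewrite -mse_sum//; last by move=> i; exact: (mdet t _ (dY i)).
have [Z dZ upZ] := upper t; apply: (le_trans (optY _ dZ)).
rewrite mse_sum//; last by move=> i; exact: (mdet t _ (dZ i)).
apply: (@le_trans _ _ (\sum_i (up t i i)%:E)%E); first exact: lee_sum.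
rewrite sumEFin lee_fin tr_quad mulr_sumr; apply: ler_sum => i _.
by rewrite -[leLHS]quad_delta.
Qed.

Lemma steady_prediction_cov_riccati (R : realType) (n m : nat) (A : 'M[R]_n)
    (C : 'M[R]_(m, n)) (sigma_w sigma_v : R) (S : 'M[R]_n) :
  steady_prediction_cov A C sigma_w sigma_v S ->
  covariance S /\ S = time_update A sigma_w (filter_cov C sigma_v S).
Proof.
move=> [ST S0 SE _]; split; first by split.
rewrite {1}SE /time_update /filter_cov mulmxBr mulmxBl !mulmxA.
by rewrite addrAC.
Qed.

Theorem theorem2 (R : realType) (d : measure_display) (T : measurableType d)
    (P : probability T R) (n p k : nat) (A : 'M[R]_n) (C : 'M[R]_(p, n))
    (sigma_w sigma_v : R) (x0 : 'I_n -> {RV P >-> R})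
    (w : nat -> 'I_n -> {RV P >-> R}) (v : nat -> 'I_p -> {RV P >-> R})
    (kappa : {set 'I_p}) (Ps : 'M[R]_n)
    (sigma_w_gt0 : 0 < sigma_w) (sigma_v_gt0 : 0 < sigma_v)
    (noise : gaussian_noise_model sigma_w sigma_v x0 w v)
    (card_kappa : #|kappa| = k)
    (Ps_steady :
      steady_prediction_cov A (sensor_rows C (~: kappa)) sigma_w sigma_v Ps) :
  exists phi : nat -> 'I_p -> {RV P >-> R},
    let x := state A x0 w in
    let y := output A C x0 w v phi in
    [/\ k_adversary k A C x0 w v kappa phi,
        forall xhat : nat -> T -> 'cV[R]_n,
          (forall t, mmse_estimator P (outputs_before y t) (x t) (xhat t)) ->
          exists2 l : R,
            steady_error P (fun t omega => x t omega - xhat t omega) l &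
            \tr Ps <= l
      & forall xhat : nat -> T -> 'cV[R]_n,
          (forall t, mmse_estimator P (outputs_before y t.+1) (x t) (xhat t)) ->
          exists2 l : R,
            steady_error P (fun t omega => x t omega - xhat t omega) l &
            \tr (filter_cov (sensor_rows C (~: kappa)) sigma_v Ps) <= l].
Proof.
have [cPs PsE] := steady_prediction_cov_riccati Ps_steady.
pose Cg := sensor_rows C (~: kappa).
pose rho := contraction sigma_w Ps.
have rho01 : 0 <= rho < 1 by exact: (contraction_itv sigma_w_gt0 Ps).
pose L (_ : nat) := kalman_gain Cg sigma_v Ps.
pose c := initial_energy x0.
have c0 : 0 <= c by exact: (initial_energy_ge0 noise).
exists (jam A C x0 w v kappa) => x y; split; first exact: k_adversary_jam.
- move=> xhat mmse; exists (\tr Ps) => //.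
  apply: (mmse_steady_error (lo := riccati A Cg sigma_w sigma_v)
    (up := steady_gain_cov A Cg sigma_w sigma_v Ps c) rho01 _ _ mmse).
  + by move=> t f; exact: measurable_outputs_before.
  + by move=> t i; exact: measurable_state.
  + move=> t g i /outputs_before_good dg.
    have white := @white_coefs R n #|~: kappa| t sigma_w sigma_v.
    rewrite -(kalman_gram A Cg sigma_v_gt0 white (leqnn t)).
    apply: (mse_lower_bound sigma_w_gt0 sigma_v_gt0 noise i (leqnn t) (leqnn t) _ _ dg).
      by rewrite (kerr_cross A Cg white)// (kalman_gram A Cg sigma_v_gt0 white).
    by move=> s; exact: (kerr_orth A Cg sigma_v_gt0 white (leqnn t)).
  + by move=> t u; exact: riccati_lower.
  + move=> t; exists (estimate A C x0 w v L t).
      exact: determined_by_estimate.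
    move=> i; rewrite -(steady_gain_gram A C sigma_w sigma_v kappa Ps c (leqnn t)).
    apply: le_trans (error_energy_le sigma_w_gt0 sigma_v_gt0 noise _ _ i).
    rewrite le_eqVlt; apply/orP; left; apply/eqP; apply: eq_integral => omega _.
    rewrite -(prediction_error A C x0 w v sigma_w_gt0 sigma_v_gt0 L omega (leqnn t)).
    by rewrite !mxE.
  + by move=> t u; exact: steady_gain_upper.
- move=> xhat mmse; exists (\tr (filter_cov Cg sigma_v Ps)) => //.
  apply: (mmse_steady_error
    (lo := fun t => filter_cov Cg sigma_v (riccati A Cg sigma_w sigma_v t))
    (up := fun t => measurement_update Cg sigma_v (kalman_gain Cg sigma_v Ps)
      (steady_gain_cov A Cg sigma_w sigma_v Ps c t)) rho01 _ _ mmse).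
  + by move=> t f; exact: measurable_outputs_before.
  + by move=> t i; exact: measurable_state.
  + move=> t g i /outputs_before_good dg.
    have white := @white_coefs R n #|~: kappa| t.+1 sigma_w sigma_v.
    rewrite -(kalman_fgram A Cg sigma_v_gt0 white (ltnSn t)).
    apply: (mse_lower_bound sigma_w_gt0 sigma_v_gt0 noise i (leqnSn t) (leqnn _) _ _ dg).
      rewrite (kalman_fgram A Cg sigma_v_gt0 white (ltnSn t)).
      by rewrite (kferr_cross white)// (kerr_cross A Cg white).
    by move=> s; exact: (kferr_orth A Cg sigma_v_gt0 white (ltnSn t)).
  + by move=> t u; exact: fcov_riccati_lower.
  + move=> t; exists (filtered_estimate A C x0 w v L t).
      exact: determined_by_filtered_estimate.
    move=> i; rewrite -(steady_gain_fgram A C sigma_w sigma_v kappa Ps c (ltnSn t)).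
    apply: le_trans (error_energy_le sigma_w_gt0 sigma_v_gt0 noise _ _ i).
    rewrite le_eqVlt; apply/orP; left; apply/eqP; apply: eq_integral => omega _.
    rewrite -(filtering_error A C x0 w v sigma_w_gt0 sigma_v_gt0 L omega (ltnSn t)).
    by rewrite !mxE.
  + by move=> t u; exact: fcov_steady_gain_upper.
Qed.
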